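(* Let $\Lambda_1,\Lambda_2,\Gamma_1,\Gamma_2$ be discrete countable groups. If $\Lambda_1$ strictly measurably imbeds into $\Gamma_1$ and $\Lambda_2$ strictly measurably imbeds into $\Gamma_2$, then the free product $\Lambda_1 * \Lambda_2$ strictly measurably imbeds into $\Gamma_1 * \Gamma_2$. Moreover, for given $(\Lambda_i\rightarrowtail\Gamma_i)$-couplings $\Sigma_i$ with indices $[\Gamma_i:\Lambda_i]_{\Sigma_i}=c_i$ for $i=1,2$, one can find a $(\Lambda_1*\Lambda_2\rightarrowtail\Gamma_1*\Gamma_2)$-coupling $\Sigma$ where $$[\Gamma_1 * \Gamma_2:\Lambda_1 * \Lambda_2]_{\Sigma} = \begin{cases} 1, & \text{if } c_1=c_2=1,\\ \infty, & \text{otherwise.}\end{cases}$$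
   Context: All groups are discrete and countable, all measure spaces are standard, and all set equalities are almost everywhere equalities (the symmetric difference of the two sets is null). For a measure preserving action of a countable group $\Delta$ on $(\Sigma,\mu)$, a fundamental domain is a measurable set $Z\subset\Sigma$ with $\Sigma=\bigsqcup_{\delta\in\Delta}\delta Z$. A group $\Lambda$ strictly measurably imbeds (SMI) into a group $\Gamma$ if there exists an infinite measure space $(\Sigma,\mu)$ with a measurable, measure preserving action of $\Lambda\times\Gamma$, so that the actions of $\Lambda$ and of $\Gamma$ on $\Sigma$ admit Borel fundamental domains $Y$ and $X$ respectively (so $Y\cong\Sigma/\Lambda$ and $X\cong\Sigma/\Gamma$), such that $X$ has finite measure and $X\subset Y$. The space $(\Sigma,\mu)$ is called a $(\Lambda\rightarrowtail\Gamma)$-coupling, or SMI-coupling. Its index is the ratio $[\Gamma:\Lambda]_\Sigma := \mu(Y)/\mu(X)\in[1,\infty]$, which does not depend on the choices of the fundamental domains. *)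

(* Defs.v *)
(* MathComp + MathComp-Analysis. *)
From HB Require Import structures.
From mathcomp Require Import all_boot all_order all_algebra.
From mathcomp Require Import all_classical all_reals all_analysis.

Set Implicit Arguments.
Unset Strict Implicit.
Unset Printing Implicit Defensive.

Import Order.TTheory GRing.Theory Num.Theory.
Import numFieldNormedType.Exports.
Local Open Scope classical_set_scope.
Local Open Scope ring_scope.

Section FreeProductWords.
Variables G H : groupType.

Definition letter_neq1 (a : G + H) : bool :=
  match a with inl g => g != 1%g | inr h => h != 1%g end.

Definition letter_alt (a b : G + H) : bool :=
  match a, b with inl _, inr _ | inr _, inl _ => true | _, _ => false end.

Definition reduced_word (w : seq (G + H)) : bool :=
  all letter_neq1 w && sorted letter_alt w.

(* Left multiplication of a reduced word by a letter. *)
Definition word_cons (a : G + H) (w : seq (G + H)) : seq (G + H) :=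
  if ~~ letter_neq1 a then w else
  match a, w with
  | inl g, inl g' :: w' =>
      if (g * g')%g == 1%g then w' else inl (g * g')%g :: w'
  | inr h, inr h' :: w' =>
      if (h * h')%g == 1%g then w' else inr (h * h')%g :: w'
  | _, _ => a :: w
  end.

Definition word_mul (u v : seq (G + H)) : seq (G + H) := foldr word_cons v u.

Definition letter_inv (a : G + H) : G + H :=
  match a with inl g => inl g^-1%g | inr h => inr h^-1%g end.

Definition word_inv (u : seq (G + H)) : seq (G + H) :=
  rev (map letter_inv u).

Lemma reduced_cons a w : reduced_word (a :: w) =
  [&& letter_neq1 a, path letter_alt a w & all letter_neq1 w].
Proof. by rewrite /reduced_word /= -andbA [_ && path _ _ _]andbC. Qed.

Lemma reduced_tail a w : reduced_word (a :: w) -> reduced_word w.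
Proof.
rewrite /reduced_word /= => /andP[/andP[_ ->]] /=.
exact: path_sorted.
Qed.

Lemma word_cons_reduced a w : reduced_word w -> reduced_word (word_cons a w).
Proof.
move=> rw; rewrite /word_cons; case: ifPn => // /negbNE na.
case: a na => [g|h] /= ng; case: w rw => [|[g'|h'] w] rw;
  try case: eqVneq => [_|n1]; try exact: reduced_tail rw;
  rewrite ?reduced_cons /= ?ng ?n1 //=;
  move: rw; rewrite reduced_cons => /and3P[ng' p aw]; rewrite ?ng' ?p ?aw //;
  by rewrite andbT; case: w p {aw}.
Qed.

Lemma word_mul_reduced u v : reduced_word v -> reduced_word (word_mul u v).
Proof. by move=> rv; elim: u => //= a u IH; exact: word_cons_reduced. Qed.

Lemma word_cons1l w : word_cons (inl 1%g) w = w.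
Proof. by rewrite /word_cons /= eqxx. Qed.

Lemma word_cons1r w : word_cons (inr 1%g) w = w.
Proof. by rewrite /word_cons /= eqxx. Qed.

Lemma word_consl2 x k w : k != 1%g -> path letter_alt (inl k) w ->
  word_cons (inl x) (inl k :: w) = word_cons (inl (x * k)%g) w.
Proof.
move=> nk pw; rewrite /word_cons /=; have [->|_] := eqVneq x 1%g.
  by rewrite mul1g /= nk /=; case: w pw => [|[]].
by rewrite /=; case: (eqVneq (x * k)%g 1%g) => //= _; case: w pw => [|[]].
Qed.

Lemma word_consMl x y w : reduced_word w ->
  word_cons (inl x) (word_cons (inl y) w) = word_cons (inl (x * y)%g) w.
Proof.
have base z w' : path letter_alt (inl z) w' ->
    word_cons (inl x) (word_cons (inl z) w') = word_cons (inl (x * z)%g) w'.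
  move=> pw; have [->|nz] := eqVneq z 1%g; first by rewrite word_cons1l mulg1.
  rewrite -word_consl2 //; congr word_cons; rewrite /word_cons /= nz /=.
  by case: w' pw => [|[]].
case: w => [|[k|h] w] rw; first exact: base.
- move: rw; rewrite reduced_cons => /and3P[nk pw _].
  by rewrite !word_consl2 // base ?mulgA //; case: w pw => [|[]].
- by apply: base; move: rw; rewrite reduced_cons /= => /and3P[].
Qed.

Lemma word_consr2 x k w : k != 1%g -> path letter_alt (inr k) w ->
  word_cons (inr x) (inr k :: w) = word_cons (inr (x * k)%g) w.
Proof.
move=> nk pw; rewrite /word_cons /=; have [->|_] := eqVneq x 1%g.
  by rewrite mul1g /= nk /=; case: w pw => [|[]].
by rewrite /=; case: (eqVneq (x * k)%g 1%g) => //= _; case: w pw => [|[]].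
Qed.

Lemma word_consMr x y w : reduced_word w ->
  word_cons (inr x) (word_cons (inr y) w) = word_cons (inr (x * y)%g) w.
Proof.
have base z w' : path letter_alt (inr z) w' ->
    word_cons (inr x) (word_cons (inr z) w') = word_cons (inr (x * z)%g) w'.
  move=> pw; have [->|nz] := eqVneq z 1%g; first by rewrite word_cons1r mulg1.
  rewrite -word_consr2 //; congr word_cons; rewrite /word_cons /= nz /=.
  by case: w' pw => [|[]].
case: w => [|[h|k] w] rw; first exact: base.
- by apply: base; move: rw; rewrite reduced_cons /= => /and3P[].
- move: rw; rewrite reduced_cons => /and3P[nk pw _].
  by rewrite !word_consr2 // base ?mulgA //; case: w pw => [|[]].
Qed.

Lemma word_mul_cons a v w : reduced_word w ->
  word_mul (word_cons a v) w = word_cons a (word_mul v w).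
Proof.
move=> rw.
have [na|/negbNE na] := boolP (~~ letter_neq1 a).
  by rewrite /word_cons na.
have rv v' := word_mul_reduced v' rw.
case: a na => [g|h] /= na; case: v => [|[g'|h'] v];
  rewrite {1}/word_cons /= na //=.
- rewrite word_consMl ?rv //; case: eqVneq => [->|_] //.
  by rewrite word_cons1l.
- rewrite word_consMr ?rv //; case: eqVneq => [->|_] //.
  by rewrite word_cons1r.
Qed.

Lemma word_mulA u v w : reduced_word w ->
  word_mul u (word_mul v w) = word_mul (word_mul u v) w.
Proof. by move=> rw; elim: u => //= a u ->; rewrite word_mul_cons. Qed.

Lemma word_mul1 u : reduced_word u -> word_mul u [::] = u.
Proof.
elim: u => //= a u IH rau; rewrite IH ?(reduced_tail rau) //.
move: rau; rewrite reduced_cons /word_cons => /and3P[-> p _] /=.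
by case: a u p {IH} => [g|h] [|[]].
Qed.

Lemma word_invK : involutive word_inv.
Proof.
move=> u; rewrite /word_inv map_rev revK -map_comp map_id_in //.
by case=> x _ /=; rewrite invgK.
Qed.

Lemma word_inv_reduced u : reduced_word u -> reduced_word (word_inv u).
Proof.
rewrite /reduced_word /word_inv all_rev all_map rev_sorted sorted_map.
move=> /andP[au su]; apply/andP; split.
  by apply: sub_all au => -[x|x] /=; rewrite invg_eq1.
by apply: sub_sorted su => -[x|x] [y|y].
Qed.

Lemma word_mulVg u : reduced_word u -> word_mul (word_inv u) u = [::].
Proof.
elim: u => //= a u IH rau.
rewrite /word_mul /word_inv /= rev_cons foldr_rcons.
have -> : word_cons (letter_inv a) (a :: u) = u.
  move: rau; rewrite reduced_cons => /andP[na _].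
  by case: a na => x /= na; rewrite /word_cons /= invg_eq1 na /= mulVg eqxx.
exact: IH (reduced_tail rau).
Qed.

End FreeProductWords.

(* The free product G * H: reduced words, i.e. words in nontrivial letters   *)
(* taken alternately from G and H.                                           *)
Record free_product (G H : groupType) := FreeProduct {
  free_product_word :> seq (G + H);
  free_product_reduced : reduced_word free_product_word }.

Section FreeProductGroup.
Variables G H : groupType.
Local Notation F := (free_product G H).

HB.instance Definition _ := [isSub for @free_product_word G H].
HB.instance Definition _ := [Choice of F by <:].

Definition free_product_one : F := @FreeProduct G H [::] isT.
Definition free_product_mul (u v : F) : F :=
  FreeProduct (word_mul_reduced u (free_product_reduced v)).
Definition free_product_inv (u : F) : F :=
  FreeProduct (word_inv_reduced (free_product_reduced u)).

Lemma free_product_mulA : associative free_product_mul.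
Proof. by move=> u v w; apply: val_inj; exact: word_mulA (valP w). Qed.
Lemma free_product_mul1g : left_id free_product_one free_product_mul.
Proof. by move=> u; exact: val_inj. Qed.
Lemma free_product_mulg1 : right_id free_product_one free_product_mul.
Proof. by move=> u; apply: val_inj; exact: word_mul1 (valP u). Qed.
Lemma free_product_mulVg :
  left_inverse free_product_one free_product_inv free_product_mul.
Proof. by move=> u; apply: val_inj; exact: word_mulVg (valP u). Qed.
Lemma free_product_mulgV :
  right_inverse free_product_one free_product_inv free_product_mul.
Proof.
move=> u; apply: val_inj; rewrite /= -[X in word_mul X _]word_invK.
exact: word_mulVg (word_inv_reduced (valP u)).
Qed.

HB.instance Definition _ := isGroup.Build F free_product_mulA
  free_product_mul1g free_product_mulg1 free_product_mulVg free_product_mulgV.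

Definition free_product_inl (g : G) : F :=
  FreeProduct (word_cons_reduced (inl g) (erefl : reduced_word [::])).
Definition free_product_inr (h : H) : F :=
  FreeProduct (word_cons_reduced (inr h) (erefl : reduced_word [::])).

Lemma free_product_inlM : {morph free_product_inl : x y / (x * y)%g}.
Proof.
move=> x y; apply: val_inj => /=.
rewrite word_mul_cons /= -?word_consMl //; exact: word_cons_reduced.
Qed.

Lemma free_product_inrM : {morph free_product_inr : x y / (x * y)%g}.
Proof.
move=> x y; apply: val_inj => /=.
rewrite word_mul_cons /= -?word_consMr //; exact: word_cons_reduced.
Qed.

Theorem free_product_universal (K : groupType) (f : G -> K) (k : H -> K) :
  {morph f : x y / (x * y)%g} -> {morph k : x y / (x * y)%g} ->
  exists! phi : F -> K, [/\ {morph phi : x y / (x * y)%g},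
    forall g, phi (free_product_inl g) = f g &
    forall h, phi (free_product_inr h) = k h].
Proof.
move=> fM kM.
have f1 : f 1%g = 1%g by apply: (mulgI (f 1%g)); rewrite -fM !mulg1.
have k1 : k 1%g = 1%g by apply: (mulgI (k 1%g)); rewrite -kM !mulg1.
pose ev (a : G + H) := match a with inl g => f g | inr h => k h end.
pose evw (w : seq (G + H)) := foldr (fun a x => ev a * x)%g 1%g w.
have ev1 a : ~~ letter_neq1 a -> ev a = 1%g.
  by case: a => x /=; rewrite negbK => /eqP ->.
have evc a w : evw (word_cons a w) = (ev a * evw w)%g.
  rewrite /word_cons; case: ifPn => [/ev1 ->|_]; first by rewrite mul1g.
  case: a w => [g|h] [|[g'|h'] w] //=; case: eqVneq => [e|_] /=;
    by rewrite mulgA -?fM -?kM ?e ?f1 ?k1 ?mul1g.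
exists (fun u : F => evw u); split.
  split=> [x y|g|h] /=; last 2 first.
  - by rewrite evc /= mulg1.
  - by rewrite evc /= mulg1.
  case: x => x _ /=; elim: x => [|a x IH] /=; first by rewrite mul1g.
  by rewrite evc IH mulgA.
move=> psi [psiM psil psir]; apply/funext => -[w rw].
have psi1 : psi 1%g = 1%g by apply: (mulgI (psi 1%g)); rewrite -psiM !mulg1.
elim: w rw => [|a w IH] raw.
  by transitivity (1%g : K) => //; rewrite -psi1; congr psi; exact: val_inj.
have rw := reduced_tail raw.
have eaw : word_cons a w = a :: w.
  move: (raw); rewrite reduced_cons /word_cons => /and3P[-> p _] /=.
  by case: a w p {IH raw rw} => [g|h] [|[]].
have eF : FreeProduct raw =
    ((match a with inl g => free_product_inl g | inr h => free_product_inr h end)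
     * FreeProduct rw)%g.
  apply: val_inj; case: a eaw raw => x eaw raw;
  exact: esym (etrans (word_mul_cons _ [::] rw) eaw).
rewrite [in RHS]eF psiM -(IH rw) /=.
by case: a raw eaw {eF} => x raw eaw; rewrite ?psil ?psir.
Qed.

End FreeProductGroup.

(* A standard Borel space: Borel isomorphic to a Borel subset of a complete  *)
(* separable metric space.                                                   *)
Definition standard_borel (R : realType) d (T : measurableType d) : Prop :=
  exists (M : metricType R) (f : T -> M),
    [/\ (forall F : set_system M, ProperFilter F -> cauchy F ->
           exists x : M, F --> x),
        (exists2 D : set M, countable D & dense D),
        injective f,
        (forall B : set M, <<s @open M >> B -> measurable (f @^-1` B)) &
        (forall A : set T, measurable A -> <<s @open M >> (f @` A))].

Section Actions.
Context (R : realType) d (T : measurableType d) (mu : {measure set T -> \bar R}).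

Definition ae_eq_set (A B : set T) : Prop := mu.-negligible (A `+` B).

Definition ae_subset (A B : set T) : Prop := mu.-negligible (A `\` B).

Definition mp_action (D : groupType) (act : D -> T -> T) : Prop :=
  [/\ forall x, act 1%g x = x,
      forall g h x, act (g * h)%g x = act g (act h x),
      forall g, measurable_fun [set: T] (act g) &
      forall g (A : set T), measurable A -> mu (act g @^-1` A) = mu A].

Definition fundamental_domain (D : groupType) (act : D -> T -> T)
    (Z : set T) : Prop :=
  [/\ measurable Z,
      ae_eq_set (\bigcup_(g in [set: D]) (act g @` Z)) [set: T] &
      forall g h, g != h -> ae_eq_set (act g @` Z `&` act h @` Z) set0].

Lemma countable_group_enum (D : groupType) : countable [set: D] ->
  exists e : nat -> option D, (forall g, exists k, e k = Some g) /\
    (forall j k g, e j = Some g -> e k = Some g -> j = k).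
Proof.
move=> /countable_injP[f finj].
exists (fun k => if pselect (exists g, f g = k) is left h
                 then Some (sval (cid h)) else None).
split=> [g|j k g].
  exists (f g); case: pselect => [h|[]]; last by exists g.
  by case: cid => g' /= e; congr Some; apply: finj; rewrite ?inE.
case: pselect => // hj [ej]; case: pselect => // hk [ek].
by move: (svalP (cid hj)) (svalP (cid hk)); rewrite ej ek => <- <-.
Qed.

Lemma mp_action_image (D : groupType) (act : D -> T -> T) g (A : set T) :
  mp_action act -> act g @` A = act g^-1%g @^-1` A.
Proof.
move=> [a1 aM _ _]; apply/seteqP; split=> [_ [x Ax <-] /=|x /= Ax].
  by rewrite -aM mulVg a1.
by exists (act g^-1%g x) => //; rewrite -aM mulgV a1.
Qed.

Lemma fundamental_domain_le (D : groupType) (act : D -> T -> T) (Y Z : set T) :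
  countable [set: D] -> mp_action act -> fundamental_domain act Y ->
  fundamental_domain act Z -> (mu Y <= mu Z)%E.
Proof.
move=> /countable_group_enum[e [esurj einj]] mpa [mY _ Yd] [mZ ZT _].
have [a1 aM am apres] := mpa.
have mpre g A : measurable A -> measurable (act g @^-1` A).
  by move=> mA; rewrite -[X in measurable X]setTI; exact: am.
have mfam (F : D -> set T) : (forall g, measurable (F g)) ->
    forall k, measurable (oapp F set0 (e k)).
  by move=> mF k; case: (e k) => /=.
pose N := \bigcup_k oapp
  (fun g => if g == 1%g then set0 else act g @` Y `&` Y) set0 (e k).
have mN : measurable N.
  apply: bigcupT_measurable; apply: mfam => g; case: ifP => // _.
  by rewrite mp_action_image //; apply: measurableI => //; exact: mpre.
have N0 : mu N = 0%E.
  apply: measure_negligible => //; apply: negligible_bigcup => k.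
  case: (e k) => [g|] /=; last exact: negligible_set0.
  case: eqVneq => [_|g1]; first exact: negligible_set0.
  have := Yd g 1%g g1; rewrite /ae_eq_set setY0.
  suff -> : act 1%g @` Y = Y by [].
  by apply/seteqP; split=> [_ [x Yx <-]|x Yx]; [rewrite a1|exists x].
pose Y1 := Y `\` N.
have mY1 : measurable Y1 by exact: measurableD.
have YY1 : (mu Y <= mu Y1)%E.
  apply: (@le_trans _ _ (mu (Y1 `|` N))).
    apply: le_measure; rewrite ?inE //; first exact: measurableU.
    by move=> x Yx; have [Nx|Nx] := pselect (N x); [right|left].
  have := measureU2 mu mY1 mN; rewrite [X in (_ <= _ + X)%E](_ : _ = 0%E) //.
  by rewrite adde0.
apply: (le_trans YY1).
have [M [mM M0 ZM]] : mu.-negligible (~` \bigcup_(g in [set: D]) (act g @` Z)).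
  by apply: negligibleS ZT => x Zx; right; split.
pose F k := oapp (fun g => Y1 `&` act g @` Z) set0 (e k).
pose G k := oapp (fun g => act g @^-1` Y1 `&` Z) set0 (e k).
have mF k : measurable (F k).
  apply: mfam => g; rewrite mp_action_image //.
  by apply: measurableI => //; exact: mpre.
have mG k : measurable (G k).
  by apply: mfam => g; apply: measurableI => //; exact: mpre.
have FG k : mu (F k) = mu (G k).
  rewrite /F /G; case ek: (e k) => [g|] //=.
  rewrite -(apres g) ?mp_action_image //; last first.
    by apply: measurableI => //; exact: mpre.
  congr (mu _); apply/seteqP; split=> x /= [Yx].
    by rewrite -aM mulVg a1.
  by rewrite -aM mulVg a1.
have le1 : (mu Y1 <= mu (\bigcup_k F k))%E.
  apply: (@le_trans _ _ (mu (M `|` \bigcup_k F k))).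
    apply: le_measure; rewrite ?inE //.
      by apply: measurableU => //; exact: bigcupT_measurable.
    move=> x Y1x; have [Mx|Mx] := pselect (M x); first by left.
    have /contrapT[g _ gZx] :
        ~ ~ (\bigcup_(g in [set: D]) (act g @` Z)) x by move=> /ZM.
    by right; have [k ek] := esurj g; exists k => //; rewrite /F ek.
  have := measureU2 mu mM (bigcupT_measurable _ mF).
  by rewrite [X in (_ <= X + _)%E](_ : _ = 0%E) // add0e.
apply: (le_trans le1).
apply: (le_trans (generalized_Boole_inequality mu mF _)).
  exact: bigcupT_measurable.
rewrite (eq_eseriesr (fun k _ => FG k)) -measure_semi_bigcup //; last 2 first.
- apply/trivIsetP => i j _ _ /eqP ij; rewrite -subset0 => x.
  rewrite /G; case ei: (e i) => [g|] [] //; case ej: (e j) => [h|] //=.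
  move=> [Ygx _] [[Yhx nN] _]; apply: nN.
  have gh : (h * g^-1 != 1)%g.
    by apply/eqP => /divg1_eq hg; apply: ij; apply: einj ei _; rewrite -hg.
  have [k ek] := esurj (h * g^-1)%g; exists k => //; rewrite ek /= (negbTE gh).
  split=> //; exists (act g x); first by case: Ygx.
  by rewrite -aM mulgVK.
- exact: bigcupT_measurable.
apply: le_measure; rewrite ?inE //; first exact: bigcupT_measurable.
by move=> x [k _]; rewrite /G; case: (e k) => //= g [].
Qed.

End Actions.

(* The domains are Y = YX.1 for L and X = YX.2 for G.  Since G is countable   *)
(* in use and X has finite measure, smi_mu is sigma-finite; smi_infinite then *)
(* forces G to be infinite (for L1 = G1 = L2 = 1 and G2 = Z/2 the index of a  *)
(* finite coupling would be 2).  Action identities hold pointwise, relations  *)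
(* between sets almost everywhere.                                            *)
Record SMI_coupling (R : realType) (L G : groupType) := SMICoupling {
  smi_display : measure_display;
  smi_space : measurableType smi_display;
  smi_mu : {measure set smi_space -> \bar R};
  smi_act : (L * G)%type -> smi_space -> smi_space;
  smi_standard : standard_borel R smi_space;
  smi_infinite : smi_mu [set: smi_space] = +oo%E;
  smi_mp : mp_action smi_mu smi_act;
  smi_domains : exists YX : set smi_space * set smi_space,
    [/\ fundamental_domain smi_mu (fun l => smi_act (l, 1%g)) YX.1,
        fundamental_domain smi_mu (fun g => smi_act (1%g, g)) YX.2,
        (smi_mu YX.2 < +oo)%E &
        ae_subset smi_mu YX.2 YX.1] }.

(* Computed from an arbitrary admissible choice of fundamental domains; it   *)
(* does not depend on the choice, see smi_indexE.                            *)
Definition smi_index (R : realType) (L G : groupType)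
    (S : SMI_coupling R L G) : \bar R :=
  let YX := sval (cid (smi_domains S)) in
  (smi_mu S YX.1 / smi_mu S YX.2)%E.

Definition SMI (R : realType) (L G : groupType) : Prop :=
  inhabited (SMI_coupling R L G).

Theorem smi_indexE (R : realType) (L G : groupType)
    (S : SMI_coupling R L G) (Y X : set (smi_space S)) :
  countable [set: L] -> countable [set: G] ->
  fundamental_domain (smi_mu S) (fun l => smi_act (l, 1%g)) Y ->
  fundamental_domain (smi_mu S) (fun g => smi_act (1%g, g)) X ->
  smi_index S = (smi_mu S Y / smi_mu S X)%E.
Proof.
move=> cL cG fY fX; rewrite /smi_index; case: cid => -[Y' X'] /= [fY' fX' _ _].
have [a1 aM am ap] := smi_mp S.
have mpL : mp_action (smi_mu S) (fun l => smi_act (l, 1%g)).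
  split=> // [g h x|g A mA]; last exact: ap.
  have -> : ((g * h)%g, 1%g) = ((g, 1%g) * (h, 1%g))%g :> (L * G)%type.
    by congr pair; rewrite mulg1.
  exact: aM.
have mpG : mp_action (smi_mu S) (fun g => smi_act (1%g, g)).
  split=> // [g h x|g A mA]; last exact: ap.
  have -> : (1%g, (g * h)%g) = ((1%g, g) * (1%g, h))%g :> (L * G)%type.
    by congr pair; rewrite mulg1.
  exact: aM.
have -> : smi_mu S Y' = smi_mu S Y.
  apply/eqP; rewrite eq_le; apply/andP; split;
  exact: (fundamental_domain_le cL mpL).
suff -> : smi_mu S X' = smi_mu S X by [].
apply/eqP; rewrite eq_le; apply/andP; split;
exact: (fundamental_domain_le cG mpG).
Qed.

(* Main.v *)
(* Restricting a coupling to a fundamental domain of the target group turns   *)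

(* The argument rests on three results. [coupling_embedding] removes an invariant null set from a
   coupling and turns the rest into a [random_embedding], whose identities hold at every point. The
   slices [re_dom g] with [g] nontrivial have the measures of pieces that partition [Y] minus [X]
   almost everywhere, so the index is 1 exactly when all of them are null. This equivalence is all
   that has to be remembered of the index.

   [word_dom_ex] and [word_dom_uniq] show that over the conull invariant set [base_dom] every orbit
   of the free product meets [word_dom] exactly once. Existence is an induction on the length of the
   word. Uniqueness is a normal form argument in the manner of ping-pong ([word_step_exit]): a
   nontrivial letter moves the point out of the domain of its own factor, and the next letter,
   coming from the other factor, cannot undo this.

   [free_product_coupling] equips the skew product with the product of the two finite measures and
   the counting measure, lets the second group act by right multiplication, and computes the index
   from the slices. *)
(* it into a finite measure preserving action of Li on Xi with a cocycle      *)
(* ai : Li * Xi -> Gi such that ai(., x) is injective: X inside Y says        *)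
(* exactly that ai(l, x) = 1 only for l = 1. On X1 * X2 let L1 act on the     *)
(* first factor and L2 on the second. The cocycles extend to a cocycle of     *)
(* L1 * L2 into G1 * G2; it maps a reduced word to a product of nontrivial    *)
(* letters alternately in G1 and G2, hence is again injective, and            *)
(* X1 * X2 * (G1 * G2) is the coupling. A fundamental domain for L1 * L2      *)
(* consists of the (x, v) for which v is empty or its first letter g, in Gi   *)
(* say, satisfies (xi, g) in Yi. If both indices are 1 this forces v = 1      *)
(* almost everywhere; otherwise some letter g is allowed on a set of positive *)
(* measure, and all of the infinitely many words starting with g are then     *)
(* allowed there.                                                             *)
From HB Require Import structures.
Require Import Defs.
From mathcomp Require Import all_boot all_order all_algebra.
From mathcomp Require Import all_classical all_reals all_analysis.

Set Implicit Arguments.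
Unset Strict Implicit.
Unset Printing Implicit Defensive.

Import Order.TTheory GRing.Theory Num.Theory.
Import numFieldNormedType.Exports.
Local Open Scope classical_set_scope.
Local Open Scope ring_scope.

(** * Standard Borel spaces *)

Section ProductMetric.
Context (R : realType) (M N : metricType R).

(** The maximum, because its balls are the products of balls that already define the uniform
    structure of the product. *)
Let dist (x y : M * N) : R := Num.max (mdist x.1 y.1) (mdist x.2 y.2).

Let dist_ge0 x y : 0 <= dist x y.
Proof. by rewrite le_max mdist_ge0. Qed.

Let dist_positivity x y : dist x y = 0 -> x = y.
Proof.
move=> d0; have : dist x y <= 0 by rewrite d0.
rewrite ge_max => /andP[d1 d2]; case: x y {d0} d1 d2 => x1 x2 [y1 y2] /= d1 d2.
by congr pair; apply: mdist_positivity; apply/eqP;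
  rewrite eq_le mdist_ge0 andbT.
Qed.

Let ballEdist x e : ball x e = [set y | dist x y < e].
Proof.
by apply/seteqP; split=> y /=;
  rewrite /ball /= /prod_ball !ballEmdist /= gt_max;
  [move=> [-> ->]|move=> /andP].
Qed.

HB.instance Definition _ := @PseudoMetric_isMetric.Build R (M * N)%type
  dist dist_ge0 dist_positivity ballEdist.

End ProductMetric.

Lemma complete_prod (R : realType) (M N : metricType R) :
  (forall F : set_system M, ProperFilter F -> cauchy F ->
    exists x : M, F --> x) ->
  (forall F : set_system N, ProperFilter F -> cauchy F ->
    exists x : N, F --> x) ->
  forall F : set_system (M * N)%type, ProperFilter F -> cauchy F ->
    exists x : M * N, F --> x.
Proof.
move=> cM cN F FF /cauchy_ballP cF.
have [x Fx] : exists x : M, fst @ F --> x.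
  apply: cM; apply/cauchy_ballP => e e0; have := cF e e0.
  move=> [[P Q] /= [FP FQ] PQ]; exists (fst @` P, fst @` Q) => /=.
    split; [apply: filterS FP => z Pz; by exists z|].
    by apply: filterS FQ => z Qz; exists z.
  by move=> [_ _] /= [[u Pu <-] [v Qv <-]]; have [] := PQ (u, v) (conj Pu Qv).
have [y Fy] : exists y : N, snd @ F --> y.
  apply: cN; apply/cauchy_ballP => e e0; have := cF e e0.
  move=> [[P Q] /= [FP FQ] PQ]; exists (snd @` P, snd @` Q) => /=.
    split; [apply: filterS FP => z Pz; by exists z|].
    by apply: filterS FQ => z Qz; exists z.
  by move=> [_ _] /= [[u Pu <-] [v Qv <-]]; have [] := PQ (u, v) (conj Pu Qv).
exists (x, y) => A [[P Q] /= [nP nQ] PQ].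
have FP : F (fst @^-1` P) by exact: Fx nP.
have FQ : F (snd @^-1` Q) by exact: Fy nQ.
by apply: filterS (filterI FP FQ) => -[u v] [/= Pu Qv]; exact: (PQ (u, v)).
Qed.

Lemma borel_preimage (U V : topologicalType) (g : U -> V) (B : set V) :
  continuous g -> <<s @open V >> B -> <<s @open U >> (g @^-1` B).
Proof.
move=> cg; suff : <<s @open V >> `<=` [set C | <<s @open U >> (g @^-1` C)].
  by apply.
apply: smallest_sub.
  split; first by rewrite /= preimage_set0; exact: sigma_algebra0.
  - by move=> A sA; rewrite /= setTD preimage_setC -setTD;
      exact: sigma_algebraCD.
  - by move=> A sA; rewrite /= preimage_bigcup; exact: sigma_algebra_bigcup.
by move=> A oA; apply: sub_sigma_algebra; exact: open_comp oA.
Qed.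

Lemma sigma_algebra_setI (T : Type) (G : set (set T)) (A B : set T) :
  <<s G >> A -> <<s G >> B -> <<s G >> (A `&` B).
Proof.
move=> sA sB; rewrite -[A `&` B]setCK setCI -[~` (_ `|` _)]setTD.
apply: sigma_algebraCD; rewrite -bigcup2E;
  apply: sigma_algebra_bigcup => -[|[|n]] /=.
- by rewrite -setTD; exact: sigma_algebraCD.
- by rewrite -setTD; exact: sigma_algebraCD.
- exact: sigma_algebra0.
Qed.

Lemma separable_base (R : realType) (M : metricType R) (D : set M) :
  countable D -> dense D -> exists U : nat -> set M, (forall k, open (U k)) /\
    forall x P, nbhs x P -> exists2 k, U k x & U k `<=` P.
Proof.
move=> cD dD; pose B (p : M * nat) := (ball p.1 p.2.+1%:R^-1)°.
have /countable_injP[f fi] : countable (D `*` [set: nat]).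
  by apply: countableX => //; exact: countableP.
(* Since [f] is injective on [D * nat], this union has at most one member; it is empty when [k] is
   not a value of [f]. *)
exists (fun k => \bigcup_(p in [set p | (D `*` setT) p /\ f p = k]) B p).
split=> [k|x P /nbhs_ballP[e /= e0 eP]].
  by apply: bigcup_open => p _; exact: open_interior.
(* The choice of [n] gives [2r <= e]. With [u] within [r/2] of [x], the ball of radius [r] about [u]
   then contains a neighbourhood of [x] and lies in the ball of radius [e] about [x]. *)
pose n := Num.truncn (2 / e); pose r : R := n.+1%:R^-1.
have r0 : 0 < r by rewrite invr_gt0.
have r2e : r + r <= e.
  rewrite -mulr2n -[_ *+ 2]mulr_natl /r ler_pdivrMr // mulrC -ler_pdivrMr //.
  by rewrite ltW // truncnS_gt.
have [u [/interior_subset xu Du]] : (ball x (r / 2))° `&` D !=set0.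
  apply: dD; last exact: open_interior.
  by exists x; apply: nbhsx_ballx; rewrite divr_gt0.
have fE p : D p.1 -> f p = f (u, n) -> p = (u, n).
  by move=> Dp; apply: fi; rewrite inE; split.
exists (f (u, n)).
  exists (u, n) => //; rewrite /B /interior /=;
    apply: filterS (nbhsx_ballx x (r / 2) _) => [y xy|].
    rewrite -/r [r]splitr; apply: ball_triangle xy; exact: ball_sym.
  by rewrite divr_gt0.
move=> y [p [[Dp _] fp]]; rewrite (fE _ Dp fp) => /interior_subset /= uy.
apply: eP; apply: le_ball r2e _ _; apply: ball_triangle uy.
by apply: le_ball xu; rewrite ler_pdivrMr // ler_peMr ?ler1n // ltW.
Qed.

Lemma standard_borel_prod (R : realType) d1 d2 (T1 : measurableType d1)
    (T2 : measurableType d2) :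
  standard_borel R T1 -> standard_borel R T2 -> standard_borel R (T1 * T2)%type.
Proof.
move=> [M [f [cM [D cD dD] fi fm fo]]] [N [g [cN [E cE dE] gi gm go]]].
pose h (x : T1 * T2) := (f x.1, g x.2).
have hi : injective h by move=> [x y] [x' y'] /= [/fi -> /gi ->].
exists (M * N)%type, h; split => //.
- exact: complete_prod.
- exists (D `*` E); first exact: countableX.
  move=> O [[x y] Oxy] oO;
    have [[P Q] /= [nP nQ] PQ] := open_nbhs_nbhs (conj oO Oxy).
  have [u [Pu Du]] : P° `&` D !=set0.
    by apply: dD; [exists x|exact: open_interior].
  have [v [Qv Ev]] : Q° `&` E !=set0.
    by apply: dE; [exists y|exact: open_interior].
  by exists (u, v); split => //; apply: PQ; split; apply: interior_subset.
- suff : <<s @open (M * N)%type >> `<=` [set B | measurable (h @^-1` B)] by [].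
  apply: smallest_sub.
    split; first by rewrite /= preimage_set0.
    + by move=> A mA; rewrite /= setTD preimage_setC; exact: measurableC.
    + by move=> A mA; rewrite /= preimage_bigcup; exact: bigcupT_measurable.
  move=> O oO /=.
  (* By second countability an open set of the product is a countable union of open rectangles,
     whose preimages are measurable rectangles. *)
  have [U [oU bU]] := separable_base cD dD;
    have [V [oV bV]] := separable_base cE dE.
  suff -> : h @^-1` O = \bigcup_k \bigcup_(l in [set l | U k `*` V l `<=` O])
      ((f @^-1` U k) `*` (g @^-1` V l)).
    apply: bigcupT_measurable => k; apply: bigcup_measurable => l _.
    by apply: measurableX; [apply: fm|apply: gm]; exact: sub_sigma_algebra.
  apply/seteqP; split=> [[x y] /= Oxy|[x y] [k _ [l UV [/= Ux Vy]]]];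
    last first.
    by apply: UV; split.
  have [[P Q] /= [nP nQ] PQ] := open_nbhs_nbhs (conj oO Oxy).
  have [k Ux UP] := bU _ _ nP; have [l Vy VQ] := bV _ _ nQ.
  by exists k => //; exists l => // z [/UP ? /VQ ?]; apply: PQ; split.
- rewrite measurable_prod_measurableType.
  have sX (A : set T1) (B : set T2) : measurable A -> measurable B ->
      <<s @open (M * N)%type >> (h @` (A `*` B)).
    move=> mA mB.
    have -> : h @` (A `*` B) = fst @^-1` (f @` A) `&` snd @^-1` (g @` B).
      apply/seteqP; split=> [_ [[x y] [/= Ax By] <-]|].
        by split; [exists x|exists y].
      by move=> [_ _] [[/= x Ax <-] [y By <-]]; exists (x, y).
    apply: sigma_algebra_setI; apply: borel_preimage => /=.
    + by move=> z; exact: cvg_fst.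
    + exact: fo.
    + by move=> z; exact: cvg_snd.
    + exact: go.
  (* The sets with Borel image form a sigma-algebra: [h] is injective, so the image of a complement
     is a complement within the Borel set that is the image of the whole space. *)
  pose C := [set A | <<s @open (M * N)%type >> (h @` A)].
  suff : <<s [set A `*` B | A in measurable & B in measurable] >> `<=` C by [].
  apply: smallest_sub; last by move=> _ [A mA [B mB <-]]; exact: sX.
  split; first by rewrite /C /= image_set0; exact: sigma_algebra0.
  + move=> A sA; rewrite /C /=.
    have -> : h @` (setT `\` A) = h @` (setT `*` setT) `&` (setT `\` h @` A).
      apply/seteqP; split=> [_ [z [_ nA] <-]|z [[u _ <-]] [_ nA]].
        by split; [exists z|split => // -[w Aw /hi e]; apply: nA; rewrite -e].
      by exists u => //; split => // Au; apply: nA; exists u.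
    by apply: sigma_algebra_setI; [exact: sX|exact: sigma_algebraCD].
  + by move=> A sA; rewrite /C /= image_bigcup; exact: sigma_algebra_bigcup.
Qed.

(* The proof of countability is an argument of the type so that               *)
(* sigma-finiteness of the counting measure is inferred.                      *)
Definition discrete (G : groupType) of countable [set: G] : Type := G.

Section Discrete.
Context (G : groupType) (cG : countable [set: G]).

HB.instance Definition _ := Group.on (discrete cG).
HB.instance Definition _ := isPointed.Build (discrete cG) 1%g.
HB.instance Definition _ := @isMeasurable.Build default_measure_display
  (discrete cG) discrete_measurable discrete_measurable0
  discrete_measurableC discrete_measurableU.

Lemma sigma_finite_discrete (R : realType) :
  sigma_finite [set: discrete cG] (@counting (discrete cG) R).
Proof.
have [e [esurj _]] := countable_group_enum cG.
exists (fun k => [set g | e k = Some g]).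
  by apply/seteqP; split=> // g _; have [k ek] := esurj g; exists k.
move=> k; split=> //; rewrite /counting asboolT ?ltry //.
case: (e k) => [g|].
  by have := finite_set1 (g : discrete cG); apply: sub_finite_set => h [<-].
by have := @finite_set0 (discrete cG); apply: sub_finite_set => h.
Qed.

(* A new head constant: the sigma-finite instance of the library for          *)
(* [counting] is restricted to [nat].                                         *)
Definition discrete_counting (R : realType) : set (discrete cG) -> \bar R :=
  counting.

HB.instance Definition _ (R : realType) := Measure.on (@discrete_counting R).
HB.instance Definition _ (R : realType) :=
  @Measure_isSigmaFinite.Build _ (discrete cG) R (@discrete_counting R)
    (sigma_finite_discrete R).

(** An injection into the natural numbers places the group on the real line, where the image of any
    subset is a countable union of points. *)
Lemma standard_borel_discrete (R : realType) : standard_borel R (discrete cG).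
Proof.
have [f fi] := countable_injP _ cG.
exists (R^o : metricType R), (fun g : G => (f g)%:R); split=> //.
- by move=> F FF cF; exists (lim F); exact: (@cauchy_cvg R^o).
- exists (range (@ratr R)); last exact: (@dense_rat R).
  by apply: sub_countable (card_image_le _ _) _; exact: countableP.
- by move=> g h /eqP; rewrite eqr_nat => /eqP; apply: fi; rewrite inE.
- move=> A _; pose I (n : nat) : set R :=
    [set x | x = n%:R /\ exists2 g, A g & f g = n].
  have -> : (fun g : G => (f g)%:R) @` A = \bigcup_n I n.
    apply/seteqP; split=> [_ [g Ag <-]|x [n _ [-> [g Ag <-]]]];
      last by exists g.
    by exists (f g) => //; split=> //; exists g.
  apply: sigma_algebra_bigcup => n; rewrite /I.
  have [nA|nA] := pselect (exists2 g, A g & f g = n).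
    have -> : [set x : R | x = n%:R /\ exists2 g, A g & f g = n] =
        setT `\` ~` [set n%:R].
      apply/seteqP; split=> x; first by case=> -> _; split => //; apply.
      by case=> _ /contrapT ->.
    apply: sigma_algebraCD; apply: sub_sigma_algebra.
    apply: closed_openC; apply: accessible_closed_set1;
      apply: hausdorff_accessible.
    exact: metric_hausdorff.
  have -> : [set x : R | x = n%:R /\ exists2 g, A g & f g = n] = set0.
    by rewrite -subset0 => x [].
  exact: sigma_algebra0.
Qed.

End Discrete.

(** * Invariance of product measures *)

Section SkewProduct.
Context (R : realType) d1 d2 (T1 : measurableType d1) (T2 : measurableType d2).
Context (m1 : {measure set T1 -> \bar R}).
Context (m2 : {sigma_finite_measure set T2 -> \bar R}).

(** The product measure integrates the measures of sections. The section of the preimage at [x] is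
    the preimage under [psi x] of the section of [A] at [phi x]; what remains is a change of
    variables along [phi]. *)
Lemma skew_product_mp (phi : T1 -> T1) (psi : T1 -> T2 -> T2) :
  measurable_fun setT phi ->
  (forall A, measurable A -> m1 (phi @^-1` A) = m1 A) ->
  (forall x A, measurable A -> m2 (psi x @^-1` A) = m2 A) ->
  forall A : set (T1 * T2), measurable A ->
  ((m1 \x m2) ((fun z => (phi z.1, psi z.1 z.2)) @^-1` A) = (m1 \x m2) A)%E.
Proof.
move=> mphi m1phi m2psi A mA; rewrite /product_measure1.
transitivity (\int[m1]_x ((m2 \o xsection A) \o phi) x)%E.
  apply: eq_integral => x _ /=.
  rewrite -(m2psi x (xsection A (phi x))); last exact: measurable_xsection.
  by congr (m2 _); rewrite !xsectionE.
rewrite -(@ge0_integral_pushforward _ _ _ _ _ _ mphi m1 setT) //; last first.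
  exact: measurable_fun_xsection.
by apply: eq_measure_integral => B mB _; exact: m1phi.
Qed.

End SkewProduct.

Lemma counting_card_eq (R : realType) (T : choiceType) (A B : set T) :
  (A #= B)%card -> counting A = counting B :> \bar R.
Proof.
move=> AB; rewrite /counting.
have [[n An]|nA] := pselect (exists n, A #= `I_n)%card.
  have Bn : (B #= `I_n)%card by rewrite -(card_eql AB).
  rewrite !asboolT; [|by apply/finite_setP; exists n..].
  by rewrite (card_fset_set An) (card_fset_set Bn).
rewrite !asboolF // => /finite_setP // -[n Bn]; apply: nA; exists n.
by rewrite (card_eql AB).
Qed.

Lemma counting_bij (R : realType) (T : choiceType) (f g : T -> T) (A : set T) :
  cancel f g -> cancel g f -> counting (f @^-1` A) = counting A :> \bar R.
Proof.
move=> fK gK; apply: counting_card_eq.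
have -> : f @^-1` A = g @` A.
  apply/seteqP; split=> [x Ax|_ [x Ax <-]] /=; last by rewrite gK.
  by exists (f x).
by apply: inj_card_eq => x y _ _; exact: (can_inj gK).
Qed.

(** * The action of a free product on a skew product *)

(* The coupling restricted to a fundamental domain of [G]: a finite measure   *)
(* preserving action of [L] with a cocycle into [G]. The set [re_dom g] is    *)
(* the slice over [g] of a fundamental domain for the skew product action of  *)
(* [L] on [re_space * G], and [re_dom 1] is a conull invariant set.           *)
Record random_embedding (R : realType) (L G : groupType) := RandomEmbedding {
  re_display : measure_display;
  re_space : measurableType re_display;
  re_mu : {finite_measure set re_space -> \bar R};
  re_act : L -> re_space -> re_space;
  re_cocycle : L -> re_space -> G;
  re_dom : G -> set re_space;
  re_standard : standard_borel R re_space;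
  re_mp : mp_action re_mu re_act;
  re_cocycleM : forall l m x,
    re_cocycle (l * m)%g x = (re_cocycle l (re_act m x) * re_cocycle m x)%g;
  re_cocycle_measurable : forall l g, measurable [set x | re_cocycle l x = g];
  re_dom_measurable : forall g, measurable (re_dom g);
  re_dom_inv : forall l x, re_dom 1%g x -> re_dom 1%g (re_act l x);
  re_dom_sub : forall g x, re_dom g x -> re_dom 1%g x;
  re_dom_ex : forall g x, re_dom 1%g x ->
    exists l, re_dom (re_cocycle l x * g)%g (re_act l x);
  re_dom_uniq : forall g l x, re_dom g x ->
    re_dom (re_cocycle l x * g)%g (re_act l x) -> l = 1%g;
  re_dom_conull : re_mu (~` re_dom 1%g) = 0%E;
  re_dom_gt0 : (0 < re_mu (re_dom 1%g))%E;
  re_infinite : infinite_set [set: G] }.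

Section FreeProductAction.
Context (R : realType) (L1 L2 G1 G2 : groupType).
Context (E1 : random_embedding R L1 G1) (E2 : random_embedding R L2 G2).
Local Notation F := (free_product G1 G2).
Local Notation P := (re_space E1 * re_space E2)%type.

Lemma re_cocycle1 (L G : groupType) (E : random_embedding R L G)
    (x : re_space E) :
  re_cocycle (1%g : L) x = 1%g :> G.
Proof.
have [a1 _ _ _] := re_mp E.
by apply: (mulgI (re_cocycle 1%g x));
  rewrite mulg1 -{1}(a1 x) -re_cocycleM mulg1.
Qed.

Definition letter_act (a : L1 + L2) (x : P) : P :=
  match a with
  | inl l => (re_act l x.1, x.2)
  | inr l => (x.1, re_act l x.2)
  end.

Definition letter_cocycle (a : L1 + L2) (x : P) : F :=
  match a with
  | inl l => free_product_inl G2 (re_cocycle l x.1)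
  | inr l => free_product_inr G1 (re_cocycle l x.2)
  end.

Definition letter_step (a : L1 + L2) (z : P * F) : P * F :=
  (letter_act a z.1, (letter_cocycle a z.1 * z.2)%g).

Definition word_step (w : seq (L1 + L2)) (z : P * F) : P * F :=
  foldr letter_step z w.

Lemma free_product_inl1 (G H : groupType) : free_product_inl H (1%g : G) = 1%g.
Proof. by apply: (mulgI (free_product_inl H 1%g));
  rewrite -free_product_inlM !mulg1. Qed.

Lemma free_product_inr1 (G H : groupType) : free_product_inr G (1%g : H) = 1%g.
Proof. by apply: (mulgI (free_product_inr G 1%g));
  rewrite -free_product_inrM !mulg1. Qed.

Lemma letter_step1 a z : ~~ letter_neq1 a -> letter_step a z = z.
Proof.
have [a1 _ _ _] := re_mp E1; have [b1 _ _ _] := re_mp E2.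
case: z => [[x y] v]; case: a => l /=; rewrite negbK => /eqP ->;
  by rewrite /letter_step /= re_cocycle1 ?a1 ?b1
    ?free_product_inl1 ?free_product_inr1 mul1g.
Qed.

Lemma letter_stepMl l m z :
  letter_step (inl l) (letter_step (inl m) z) = letter_step (inl (l * m)%g) z.
Proof.
have [_ aM _ _] := re_mp E1; rewrite /letter_step /= aM.
by rewrite mulgA -free_product_inlM re_cocycleM.
Qed.

Lemma letter_stepMr l m z :
  letter_step (inr l) (letter_step (inr m) z) = letter_step (inr (l * m)%g) z.
Proof.
have [_ aM _ _] := re_mp E2; rewrite /letter_step /= aM.
by rewrite mulgA -free_product_inrM re_cocycleM.
Qed.

(** Cancellation in [word_cons] happens inside one factor, where the steps already compose as an
    action; hence [word_step] is an action of the free product. *)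
Lemma word_step_cons a w z :
  word_step (word_cons a w) z = letter_step a (word_step w z).
Proof.
rewrite /word_cons; case: ifPn => [na|_]; first by rewrite letter_step1.
case: a w => [l|l] [|[m|m] w] //=; case: eqVneq => [lm|_] /=;
  by rewrite ?letter_stepMl ?letter_stepMr // lm letter_step1 //= eqxx.
Qed.

Lemma word_step_mul u w z :
  word_step (word_mul u w) z = word_step u (word_step w z).
Proof. by elim: u => //= a u IH; rewrite word_step_cons IH. Qed.

Lemma word_step_mulr w x v g :
  word_step w (x, (v * g)%g) =
    ((word_step w (x, v)).1, ((word_step w (x, v)).2 * g)%g).
Proof. by elim: w => //= a w ->; rewrite /letter_step /= mulgA. Qed.

Definition letter_word (a : L1 + L2) (x : P) : G1 + G2 :=
  match a with
  | inl l => inl (re_cocycle l x.1)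
  | inr l => inr (re_cocycle l x.2)
  end.

Lemma letter_stepE a z :
  (letter_step a z).2 = word_cons (letter_word a z.1) z.2 :> seq (G1 + G2).
Proof.
have rv := free_product_reduced z.2.
by case: a => l /=; rewrite (word_mul_cons _ [::] rv).
Qed.

(** Only the first letter is tested, because a letter acting from the left can combine with nothing
    else in [v]. *)
Definition head_dom (x : P) (v : seq (G1 + G2)) : Prop :=
  match v with
  | [::] => True
  | inl g :: _ => re_dom g x.1
  | inr g :: _ => re_dom g x.2
  end.

Definition base_dom : set P := re_dom 1%g `*` re_dom 1%g.

Definition word_dom : set (P * F) :=
  [set z : P * F | base_dom z.1 /\ head_dom z.1 z.2].

Lemma word_step_base w z : base_dom z.1 -> base_dom (word_step w z).1.
Proof.
move=> Dz; elim: w => //= a w [D1 D2].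
by case: a => l; split=> //=; exact: re_dom_inv.
Qed.

(** [re_dom_uniq] is applied with [g] the head of the word, or with [g = 1] if the word does not
    start in [G1]. The point leaves the slice over the new letter; that letter is not 1, since the
    slice over 1 is invariant, so nothing cancels. *)
Lemma letter_step_exit_inl l (z : P * F) : l != 1%g -> base_dom z.1 ->
  (if (z.2 : seq (G1 + G2)) is inl g :: _ then re_dom g z.1.1 else True) ->
  exists g t, (letter_step (inl l) z).2 = inl g :: t :> seq (G1 + G2) /\
    ~ re_dom g (letter_step (inl l) z).1.1.
Proof.
move=> /eqP l1 [D1 _] hz; rewrite letter_stepE /=.
set c := re_cocycle l z.1.1.
have exit g : re_dom g z.1.1 -> ~ re_dom (c * g)%g (re_act l z.1.1).
  by move=> gz gz2; apply: l1; exact: re_dom_uniq gz gz2.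
have nexit : ~ re_dom c (re_act l z.1.1) by rewrite -[c]mulg1; exact: exit.
have c1 : c != 1%g by apply/eqP => c1; apply: nexit; rewrite c1;
  exact: re_dom_inv.
rewrite /word_cons /= c1 /=; case: (z.2 : seq _) hz => [|[g|g] t] hz.
- by exists c, [::].
- have cg : (c * g)%g != 1%g.
    by apply/eqP => cg; apply: (exit g hz); rewrite cg; exact: re_dom_inv.
  by rewrite (negbTE cg); exists (c * g)%g, t; split => //; exact: exit.
- by exists c, (inr g :: t).
Qed.

Lemma letter_step_exit_inr l (z : P * F) : l != 1%g -> base_dom z.1 ->
  (if (z.2 : seq (G1 + G2)) is inr g :: _ then re_dom g z.1.2 else True) ->
  exists g t, (letter_step (inr l) z).2 = inr g :: t :> seq (G1 + G2) /\
    ~ re_dom g (letter_step (inr l) z).1.2.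
Proof.
move=> /eqP l1 [_ D2] hz; rewrite letter_stepE /=.
set c := re_cocycle l z.1.2.
have exit g : re_dom g z.1.2 -> ~ re_dom (c * g)%g (re_act l z.1.2).
  by move=> gz gz2; apply: l1; exact: re_dom_uniq gz gz2.
have nexit : ~ re_dom c (re_act l z.1.2) by rewrite -[c]mulg1; exact: exit.
have c1 : c != 1%g by apply/eqP => c1; apply: nexit; rewrite c1;
  exact: re_dom_inv.
rewrite /word_cons /= c1 /=; case: (z.2 : seq _) hz => [|[g|g] t] hz.
- by exists c, [::].
- by exists c, (inl g :: t).
- have cg : (c * g)%g != 1%g.
    by apply/eqP => cg; apply: (exit g hz); rewrite cg; exact: re_dom_inv.
  by rewrite (negbTE cg); exists (c * g)%g, t; split => //; exact: exit.
Qed.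

(* Once a point has left [word_dom] it cannot return: each further letter of  *)
(* [w] puts a new letter in front of the word, and the slice over that letter *)
(* misses the current base point.                                             *)
Lemma word_step_exit w (z : P * F) : reduced_word w -> word_dom z ->
  match w with
  | [::] => True
  | inl _ :: _ => exists g t, (word_step w z).2 = inl g :: t :> seq (G1 + G2) /\
      ~ re_dom g (word_step w z).1.1
  | inr _ :: _ => exists g t, (word_step w z).2 = inr g :: t :> seq (G1 + G2) /\
      ~ re_dom g (word_step w z).1.2
  end.
Proof.
move=> + [Dz hz]; elim: w => // a w IH raw; have := IH (reduced_tail raw).
move: raw; rewrite reduced_cons => /and3P[na aw _] {}IH.
have Dw := word_step_base w Dz.
case: a na aw => l l1 aw;
  [apply: letter_step_exit_inl|apply: letter_step_exit_inr];
  rewrite -/(word_step _ _) //.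
(* For a single letter the slice condition is the assumption on [z]. For a longer word the induction
   hypothesis puts a letter of the other factor in front, and the condition is void. *)
- case: w aw IH Dw => [|[m|m] w] //= _.
    by move=> _ _; case: (z.2 : seq _) hz => [|[]].
  by move=> [g [t [-> _]]].
- case: w aw IH Dw => [|[m|m] w] //= _.
    by move=> _ _; case: (z.2 : seq _) hz => [|[]].
  by move=> [g [t [-> _]]].
Qed.

Lemma word_dom_uniq w z : reduced_word w -> word_dom z ->
  word_dom (word_step w z) -> w = [::].
Proof.
move=> rw wz [_]; have := word_step_exit rw wz.
by case: w {rw} => [|[l|l] w] // [g [t [-> /= nd]]] /nd.
Qed.

(** Induction on the length of [v]. A letter [b] brings the head of [v] into the domain of its
    factor: either the head becomes 1 and disappears, leaving a shorter word, or the point is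
    already in [word_dom]. *)
Lemma word_dom_ex x v : base_dom x ->
  exists w : free_product L1 L2, word_dom (word_step w (x, v)).
Proof.
case: v => v; elim: v x => [|a v IH] x rv Dx; first by exists 1%g.
have rv' := reduced_tail rv.
have : exists b, base_dom (letter_act b x) /\
    let y := letter_act b x in let z := word_cons (letter_word b x) (a :: v) in
    z = v \/ head_dom y z.
  move: rv; rewrite reduced_cons => /and3P[na pv _]; case: Dx => D1 D2.
  case: a na pv => g g1 pv.
  - have [l hl] := re_dom_ex g D1; exists (inl l); split.
      by split => //=; exact: re_dom_inv.
    rewrite /= word_consl2 //;
      have [e|n] := eqVneq (re_cocycle l x.1 * g)%g 1%g.
      by left; rewrite e word_cons1l.
    by right; rewrite /word_cons /= n /=; case: (v) pv => [|[]].
  - have [l hl] := re_dom_ex g D2; exists (inr l); split.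
      by split => //=; exact: re_dom_inv.
    rewrite /= word_consr2 //;
      have [e|n] := eqVneq (re_cocycle l x.2 * g)%g 1%g.
      by left; rewrite e word_cons1r.
    by right; rewrite /word_cons /= n /=; case: (v) pv => [|[]].
move=> [b [Dy hb]].
pose z : P * F := (x, FreeProduct rv).
have bE : letter_step b z = (letter_act b x, (letter_step b z).2) by [].
have rb : reduced_word (word_cons b [::]) by apply: word_cons_reduced.
case: hb => [hv|hy].
  have [w hw] := IH _ rv' Dy; exists (w * FreeProduct rb)%g.
  rewrite /= word_step_mul word_step_cons /=.
  suff -> : letter_step b z = (letter_act b x, FreeProduct rv') by [].
  rewrite bE; congr pair; apply: val_inj => /=.
  exact: etrans (letter_stepE b z) hv.
exists (FreeProduct rb).
have -> : word_step (FreeProduct rb) (x, FreeProduct rv) = letter_step b z.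
  exact: (word_step_cons b [::] z).
by split => //; rewrite (letter_stepE b z).
Qed.

End FreeProductAction.

(** * Couplings as random embeddings *)

Section CountableActions.
Context (R : realType) d (T : measurableType d).
Context (mu : {measure set T -> \bar R}).
Context (D : groupType) (cD : countable [set: D]).

Lemma negligible_bigcup_countable (F : D -> set T) :
  (forall g, mu.-negligible (F g)) -> mu.-negligible (\bigcup_g F g).
Proof.
move=> F0; have [e [esurj _]] := countable_group_enum cD.
apply: (@negligibleS _ _ _ _ (\bigcup_k oapp F set0 (e k))).
  by move=> x [g _ Fgx]; have [k ek] := esurj g; exists k => //; rewrite ek.
by apply: negligible_bigcup => k; case: (e k) => //=; exact: negligible_set0.
Qed.

Lemma measure_bigcup_eq (A B : D -> set T) :
  (forall g, measurable (A g)) -> (forall g, measurable (B g)) ->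
  (forall g h x, A g x -> A h x -> g = h) ->
  (forall g h x, B g x -> B h x -> g = h) ->
  (forall g, mu (A g) = mu (B g)) -> mu (\bigcup_g A g) = mu (\bigcup_g B g).
Proof.
move=> mA mB dA dB AB; have [e [esurj einj]] := countable_group_enum cD.
have enum (C : D -> set T) : \bigcup_g C g = \bigcup_k oapp C set0 (e k).
  apply/seteqP; split=> [x [g _ Cx]|x [k _]]; last by case: (e k) => // g;
    exists g.
  by have [k ek] := esurj g; exists k => //; rewrite ek.
have sum (C : D -> set T) : (forall g, measurable (C g)) ->
    (forall g h x, C g x -> C h x -> g = h) ->
    mu (\bigcup_g C g) = (\sum_(k <oo) mu (oapp C set0 (e k)))%E.
  move=> mC dC; have mC' k :
    measurable (oapp C set0 (e k)) by case: (e k) => /=.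
  rewrite enum measure_semi_bigcup //; last exact: bigcupT_measurable.
  apply/trivIsetP => i j _ _ /eqP ij; rewrite -subset0 => x /=.
  case ei: (e i) => [g|] []; case ej: (e j) => [h|] //= gx hx.
  by apply: ij; apply: einj ei _; rewrite (dC _ _ _ gx hx).
by rewrite !sum //; apply: eq_eseriesr => k _; case: (e k) => /= [g|//];
  exact: AB.
Qed.

Context (act : D -> T -> T) (mpa : mp_action mu act).

Lemma mp_action_measurable g A : measurable A -> measurable (act g @^-1` A).
Proof.
by have [_ _ am _] := mpa => mA; rewrite -[X in measurable X]setTI; exact: am.
Qed.

Lemma mp_actionV g z : act g^-1%g (act g z) = z.
Proof. by have [a1 aM _ _] := mpa; rewrite -aM mulVg a1. Qed.

Lemma mp_action_negligible g A :
  mu.-negligible A -> mu.-negligible (act g @^-1` A).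
Proof.
move=> [B [mB B0 AB]]; exists (act g @^-1` B); split.
- exact: mp_action_measurable.
- by have [_ _ _ ->] := mpa.
- by move=> x /AB.
Qed.

(** The union of all translates of a measurable null cover of [A]. Removing it turns almost
    everywhere statements into pointwise ones without breaking the action. *)
Lemma invariant_hull A : mu.-negligible A -> exists N : set T,
  [/\ measurable N, mu N = 0%E, A `<=` N & forall g z, N (act g z) <-> N z].
Proof.
move=> [B [mB B0 AB]]; have [a1 aM _ _] := mpa.
have mF g : measurable (act g @^-1` B) by exact: mp_action_measurable.
exists (\bigcup_g act g @^-1` B); split.
- exact: countable_bigcupT_measurable.
- apply: measure_negligible; first exact: countable_bigcupT_measurable.
  apply: negligible_bigcup_countable => g; apply: mp_action_negligible.
  by exists B; split.
- by move=> z /AB Bz; exists 1%g => //=; rewrite a1.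
- move=> g z; split=> -[h _ /= Bz].
    by exists (h * g)%g => //=; rewrite aM.
  by exists (h * g^-1)%g => //=; rewrite -aM mulgVK.
Qed.

(** An exceptional point is missed by all translates of [Z] or lies in two of them; both happen on
    null sets, the second because there are countably many pairs. *)
Lemma fundamental_domain_uniq Z : fundamental_domain mu act Z ->
  mu.-negligible (~` [set z | exists! g, Z (act g z)]).
Proof.
move=> [mZ ZT Zd].
apply: (@negligibleS _ _ _ _ ((~` \bigcup_(g in [set: D]) (act g @` Z)) `|`
  \bigcup_g \bigcup_h if g == h then set0 else act g @` Z `&` act h @` Z)).
  move=> z nz; have [[g _ [x Zx xz]]|nc] :=
    pselect ((\bigcup_(g in [set: D]) (act g @` Z)) z); last by left.
  right; have Zg : Z (act g^-1%g z) by rewrite -xz mp_actionV.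
  have /existsNP[h /not_implyP[Zh gh]] : ~ forall h, Z (act h z) -> g^-1%g = h.
    by move=> u; apply: nz; exists g^-1%g; split.
  exists g => //; exists h^-1%g => //; case: eqVneq => [e|_].
    by apply: gh; rewrite e invgK.
  by split; [exists x|exists (act h z) => //; rewrite mp_actionV].
apply: negligibleU.
  by apply: negligibleS ZT => z nz; right; split.
apply: negligible_bigcup_countable => g;
  apply: negligible_bigcup_countable => h.
case: eqVneq => [_|gh]; first exact: negligible_set0.
by have := Zd g h gh; rewrite /ae_eq_set setY0.
Qed.

End CountableActions.

Section ProductAction.
Context (R : realType) d (T : measurableType d).
Context (mu : {measure set T -> \bar R}).
Context (G H : groupType) (act : G * H -> T -> T) (mpa : mp_action mu act).

Lemma mp_action_fst : mp_action mu (fun g => act (g, 1%g)).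
Proof.
have [a1 aM am ap] := mpa; split=> // [g h x|g A mA]; last exact: ap.
by rewrite -aM; congr act; congr pair; rewrite mulg1.
Qed.

Lemma mp_action_snd : mp_action mu (fun h => act (1%g, h)).
Proof.
have [a1 aM am ap] := mpa; split=> // [g h x|g A mA]; last exact: ap.
by rewrite -aM; congr act; congr pair; rewrite mulg1.
Qed.

End ProductAction.

(** * Restriction of a coupling to a fundamental domain of the target group *)

Section CouplingRestriction.
Context (R : realType) (L G : groupType) (S : SMI_coupling R L G).
Context (cG : countable [set: G]).
Local Notation T := (smi_space S).
Local Notation mu := (smi_mu S).
Local Notation actL l := (smi_act (l, 1%g)).
Local Notation actG g := (smi_act (1%g, g)).
Context (X Y N : set T) (mX : measurable X) (mY : measurable Y)
  (mN : measurable N) (N0 : mu N = 0%E) (Xfin : (mu X < +oo)%E).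
Context (Ninv : forall p z, N (smi_act p z) <-> N z)
  (XY : forall z, ~ N z -> X z -> Y z)
  (Yex : forall z, ~ N z -> exists! l, Y (actL l z))
  (Xex : forall z, ~ N z -> exists! g, X (actG g z)).

Let D := X `\` N.

Let mD : measurable D. Proof. exact: measurableD. Qed.

(** The return element: off [N], the unique element of [G] that brings [z] into [X]. *)
Let r (z : T) : G := xget 1%g [set g | X (actG g z)].

Let r_mem z : ~ N z -> X (actG (r z) z).
Proof.
move=> /Xex[g [Xg _]].
by have : [set h | X (actG h z)] (r z) by apply: xgetPex; exists g.
Qed.

Let r_uniq z g : ~ N z -> X (actG g z) -> r z = g.
Proof.
move=> nN Xg; have [h [_ hu]] := Xex nN.
by rewrite -(hu _ Xg) -(hu _ (r_mem nN)).
Qed.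

Let act1 z : smi_act 1%g z = z :> T.
Proof. by have [a1 _ _ _] := smi_mp S; exact: a1. Qed.

Let actM p q z : smi_act (p * q)%g z = smi_act p (smi_act q z) :> T.
Proof. by have [_ aM _ _] := smi_mp S; exact: aM. Qed.

Let actMP l g m h z :
  smi_act (l, g) (smi_act (m, h) z) = smi_act ((l * m)%g, (g * h)%g) z :> T.
Proof. by rewrite -actM. Qed.

Let actGL l g z : smi_act (l, g) z = actG g (actL l z) :> T.
Proof. by rewrite actMP mul1g mulg1. Qed.

Let nN_act p z : ~ N z -> ~ N (smi_act p z : T).
Proof. by move=> nN /Ninv. Qed.

Let r_act g z : ~ N z -> r (actG g z) = (r z * g^-1)%g.
Proof.
move=> nN; apply: r_uniq; first exact: nN_act.
by rewrite actMP mulgVK mulg1; exact: r_mem.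
Qed.

Let r_D z : D z -> r z = 1%g.
Proof. by move=> [Xz nN]; apply: r_uniq => //; rewrite act1. Qed.

(* The identity off [D], so that the action identities hold at every point. *)
Let act (l : L) (x : T) : T :=
  if pselect (D x) then actG (r (actL l x)) (actL l x) else x.

Let cocycle (l : L) (x : T) : G :=
  if pselect (D x) then r (actL l x) else 1%g.

Let actE l x : D x -> act l x = smi_act (l, r (actL l x)) x.
Proof. by rewrite /act; case: pselect => //= _ _;
  rewrite actMP mul1g mulg1. Qed.

Let actN l x : ~ D x -> act l x = x.
Proof. by rewrite /act; case: pselect. Qed.

Let cocycleE l x : D x -> cocycle l x = r (actL l x).
Proof. by rewrite /cocycle; case: pselect. Qed.

Let act_D l x : D x -> D (act l x).
Proof.
move=> Dx; rewrite actE //; case: Dx => Xx nN; split; last exact: nN_act.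
by have := r_mem (@nN_act (l, 1%g) _ nN); rewrite actMP mul1g mulg1.
Qed.

Let r_actE l m x : D x ->
  r (actL l (act m x)) = (r (actL (l * m)%g x) * (r (actL m x))^-1)%g.
Proof.
move=> Dx; rewrite actE // actMP mul1g.
by rewrite actGL r_act //; apply: nN_act; case: Dx.
Qed.

Let actA l m x : act (l * m)%g x = act l (act m x).
Proof.
have [Dx|nD] := pselect (D x); last by rewrite !actN.
rewrite (actE _ (act_D _ Dx)) r_actE // [in RHS]actE // !actE // actMP.
by rewrite mulgVK.
Qed.

Let act_id x : act 1%g x = x.
Proof.
have [Dx|nD] := pselect (D x); last by rewrite actN.
by rewrite actE // act1 r_D // act1.
Qed.

Let cocycleM l m x :
  cocycle (l * m)%g x = (cocycle l (act m x) * cocycle m x)%g.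
Proof.
have [Dx|nD] := pselect (D x).
  by rewrite !cocycleE ?r_actE // ?mulgVK //; exact: act_D.
by rewrite actN // /cocycle; case: pselect => //= _; rewrite mulg1.
Qed.

Let mact p A : measurable A -> measurable ((smi_act p : T -> T) @^-1` A).
Proof. by move=> mA; apply: (mp_action_measurable (smi_mp S)). Qed.

(** The part of [D] where the cocycle of [l] equals [g]. There [act l] is the action of the single
    element [(l, g)], which reduces measurability and invariance to countably many pieces. *)
Let piece l g : set T := D `&` (smi_act (l, g) : T -> T) @^-1` D.

Let mpiece l g : measurable (piece l g).
Proof. by apply: measurableI => //; exact: mact. Qed.

Let pieceP l g x : piece l g x <-> D x /\ r (actL l x) = g.
Proof.
split=> [[Dx [Xx _]]|[Dx <-]].
  split=> //; apply: r_uniq; first by apply: nN_act; case: Dx.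
  by rewrite actMP mul1g mulg1.
by split => //; have := act_D l Dx; rewrite actE //.
Qed.

Let pieceE l g x : piece l g x -> act l x = smi_act (l, g) x.
Proof. by move=> /pieceP[Dx <-]; rewrite actE. Qed.

Let mcocycle l g : measurable [set x | cocycle l x = g].
Proof.
have -> : [set x | cocycle l x = g] =
    piece l g `|` (~` D `&` [set _ | 1%g = g]).
  apply/seteqP; split=> x /=.
    have [Dx|nD] := pselect (D x).
      by rewrite cocycleE // => rg; left; apply/pieceP.
    by rewrite /cocycle; case: pselect => //= _ e; right.
  move=> [/pieceP[Dx <-]|[nD <-]]; first by rewrite cocycleE.
  by rewrite /cocycle; case: pselect.
apply: measurableU => //; apply: measurableI; first exact: measurableC.
have [<-|n] := pselect (1%g = g).
  by have -> : [set _ : T | 1%g = 1%g :> G] = setT by apply/seteqP.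
by have -> : [set _ : T | 1%g = g] = set0 by rewrite -subset0.
Qed.

Let act_preimage l A : act l @^-1` A =
  (~` D `&` A) `|` \bigcup_g (piece l g `&` (smi_act (l, g) : T -> T) @^-1` A).
Proof.
apply/seteqP; split=> x /=.
  have [Dx|nD] := pselect (D x); last by rewrite actN //; left.
  by rewrite actE // => Ax; right; exists (r (actL l x)) => //; split => //;
    apply/pieceP.
move=> [[nD Ax]|[g _ [px /= Ax]]]; first by rewrite actN.
by rewrite (pieceE px).
Qed.

Let mact' l : measurable_fun [set: T] (act l).
Proof.
move=> _ A mA; rewrite setTI act_preimage; apply: measurableU.
  by apply: measurableI => //; exact: measurableC.
apply: countable_bigcupT_measurable => // g.
by apply: measurableI; [exact: mpiece|exact: mact].
Qed.

Let Dfin : (mu D < +oo)%E.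
Proof. by apply: le_lt_trans Xfin; apply: le_measure; rewrite ?inE //;
  exact: subDsetl. Qed.

(** A measure on all of [T] concentrated on [D], so that the standard Borel space of the coupling is
    kept. *)
Let nu : {finite_measure set T -> \bar R} := mfrestr mD Dfin.

Let nuE A : nu A = mu (A `&` D).
Proof. by []. Qed.

(** The element [(l, g)] maps [piece l g] onto [piece l^-1 g^-1] and preserves [mu]; both sides are
    cut along these pieces. *)
Let act_mp l A : measurable A -> nu (act l @^-1` A) = nu A.
Proof.
move=> mA; rewrite !nuE.
have [_ _ _ ap] := smi_mp S.
pose B g := A `&` piece l^-1%g g^-1%g.
have mB g : measurable (B g) by apply: measurableI.
have -> : A `&` D = \bigcup_g B g.
  apply/seteqP; split=> x; last by move=> [g _ [Ax [Dx _]]].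
  move=> [Ax Dx]; exists (r (actL l^-1%g x))^-1%g => //; split => //.
  by rewrite invgK; apply/pieceP.
have pB g x : piece l g x <-> piece l^-1%g g^-1%g (smi_act (l, g) x).
  by rewrite /piece /= actMP !mulVg act1; split=> -[].
have -> : act l @^-1` A `&` D = \bigcup_g ((smi_act (l, g) : T -> T) @^-1` B g).
  apply/seteqP; split=> x.
    rewrite act_preimage => -[[[nD _]|[g _ [px Ax]]] Dx] //.
    by exists g => //; split => //; apply/pB.
  move=> [g _ [Ax /pB px]]; split; last by case: px.
  by rewrite /= (pieceE px).
apply: measure_bigcup_eq => //.
- by move=> g; exact: mact.
- by move=> g h x [_ /pB/pieceP[_ <-]] [_ /pB/pieceP[_ <-]].
- by move=> g h x [_ /pieceP[_ rg]] [_ /pieceP[_ rh]]; apply: invg_inj;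
    rewrite -rg -rh.
- by move=> g; exact: ap.
Qed.

(** Off [N] the space is [D * G], the pair [(x, g)] standing for the point [g^-1 x]. In these
    coordinates this is the slice of [Y] over [g]. *)
Let dom g : set T := D `&` (smi_act (1%g, g^-1%g) : T -> T) @^-1` Y.

Let mdom g : measurable (dom g).
Proof. by apply: measurableI => //; exact: mact. Qed.

(** The inclusion of [X] in [Y] enters here. Through [re_dom_uniq] it makes the cocycle injective in
    the group element. *)
Let dom1 : dom 1%g = D.
Proof.
apply/seteqP; split=> x [] // Xx nN.
by split => //=; rewrite invg1 act1; exact: XY.
Qed.

Let dom_actP g l x : D x ->
  dom (cocycle l x * g)%g (act l x) <-> Y (actL l (actG g^-1%g x)).
Proof.
move=> Dx; rewrite /dom /= cocycleE // actE // !actMP invgM mulgVK !mul1g mulg1.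
split=> [[]//|Yz]; split => //; have := act_D l Dx; rewrite actE //.
Qed.

Let translate_cover : ~` N = \bigcup_g (actG g @^-1` D).
Proof.
apply/seteqP; split=> z; last by move=> [g _ [_]] nN /(Ninv (1%g, g)).
by move=> nN; exists (r z) => //; split; [exact: r_mem|exact: nN_act].
Qed.

Let mu_translate g : mu (actG g @^-1` D) = mu D.
Proof. by have [_ _ _ ap] := smi_mp S; exact: ap. Qed.

Let mu_nN : mu (~` N) = +oo%E.
Proof.
apply/eqP; rewrite -leye_eq -(smi_infinite S).
apply: (@le_trans _ _ (mu (N `|` ~` N))); first by rewrite setUv.
have mnN : measurable (~` N) by exact: measurableC.
have := measureU2 mu mN mnN.
by rewrite [X in (_ <= X + _)%E](_ : _ = 0%E) // add0e.
Qed.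

Let D_gt0 : (0 < mu D)%E.
Proof.
rewrite lt0e measure_ge0 andbT; apply/eqP => D0.
have : mu.-negligible (~` N).
  rewrite translate_cover; apply: negligible_bigcup_countable => // g.
  apply/negligibleP; first exact: mact.
  by rewrite /= mu_translate.
move=> /negligibleP => /(_ (measurableC mN)); rewrite /= mu_nN => /eqP.
by [].
Qed.

Lemma coupling_domain_gt0 : (0 < mu X)%E.
Proof.
by apply: lt_le_trans D_gt0 _; apply: le_measure; rewrite ?inE //;
  exact: subDsetl.
Qed.

(** Finitely many translates of [D] have finite total measure, while all of them together cover a
    set of infinite measure. *)
Let G_infinite : infinite_set [set: G].
Proof.
move=> /finite_seqP[s sE].
have : (mu (\bigcup_g (actG g @^-1` D)) < +oo)%E; last first.
  by rewrite -translate_cover mu_nN ltxx.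
rewrite sE bigcup_seq.
have : measurable (\big[setU/set0]_(g <- s) (actG g @^-1` D : set T)) /\
  (mu (\big[setU/set0]_(g <- s) (actG g @^-1` D)) < +oo)%E; last by case.
elim/big_rec : _ => [|g A _ [mA Afin]]; first by rewrite measure0.
have mg : measurable (actG g @^-1` D : set T) by exact: mact.
split; first exact: measurableU.
apply: le_lt_trans (measureU2 mu mg mA) _.
apply: lte_add_pinfty; last exact: Afin.
have gfin : (mu (actG g @^-1` D) < +oo)%E by rewrite mu_translate.
exact: gfin.
Qed.

(** Up to [N] these pieces partition [Y] minus [X]. For [g] nontrivial, [g^-1] carries [dom g] onto
    [rest g], hence [mu_dom]; the piece over 1 is empty. *)
Let rest g : set T := ((Y `\` X) `\` N) `&` actG g @^-1` D.

Let mrest g : measurable (rest g).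
Proof. by apply: measurableI; [apply: measurableD => //;
  exact: measurableD|exact: mact]. Qed.

Let mu_dom g : g != 1%g -> mu (dom g) = mu (rest g).
Proof.
move=> /eqP g1; have [_ _ _ ap] := smi_mp S.
rewrite -(ap (1%g, g^-1%g) _ (mrest g)); congr (mu _); apply/seteqP; split=> x.
  move=> [Dx Yx]; split; last by rewrite /= actMP mulgV mulg1 act1.
  split; last by apply: nN_act; case: Dx.
  split => // Xx; apply: g1; apply: invg_inj; rewrite invg1 -(r_D Dx).
  by apply/esym/r_uniq => //; case: Dx.
by move=> [[[Yx _] _]]; rewrite /= actMP mulgV mulg1 act1.
Qed.

Let rest1 : rest 1%g = set0.
Proof. by rewrite -subset0 => z [[[_ nX] _]] [] /=; rewrite act1. Qed.

Lemma restriction_embedding : exists E : random_embedding R L G,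
  (forall g, g != 1%g -> re_mu E (re_dom g) = 0%E) <-> mu (Y `\` X) = 0%E.
Proof.
have mp : mp_action nu act.
  split; [exact: act_id|exact: actA|exact: mact'|exact: act_mp].
have nuD A : A `<=` D -> nu A = mu A by move=> AD; rewrite nuE setIidl.
(* The fields [re_dom_ex] and [re_dom_uniq] are existence and uniqueness of the return of [g^-1 x]
   to [Y], read through [dom_actP]. *)
exists (@RandomEmbedding R L G _ T nu act cocycle dom (smi_standard S) mp
  cocycleM mcocycle mdom
  ltac:(by move=> l x; rewrite dom1; exact: act_D)
  ltac:(by move=> g x [Dx _]; rewrite dom1)
  ltac:(by move=> g x; rewrite dom1 => Dx;
     have [l [Yl _]] := Yex (@nN_act (1%g, g^-1%g) _ Dx.2);
     exists l; apply/dom_actP)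
  ltac:(by move=> g l x [Dx Yx] /dom_actP => /(_ Dx) Yl;
     have [m [_ mu]] := Yex (@nN_act (1%g, g^-1%g) _ Dx.2);
     rewrite -(mu _ Yl); apply: mu; rewrite act1)
  ltac:(by rewrite dom1 nuE setICl measure0)
  ltac:(by rewrite dom1 nuD)
  G_infinite) => /=.
have mR : measurable (Y `\` X) by exact: measurableD.
split=> [h|YX0 g g1].
  apply: measure_negligible => //.
  apply: (@negligibleS _ _ _ _ (N `|` \bigcup_g rest g)).
    move=> z YXz; have [Nz|nN] := pselect (N z); [by left|right].
    have : (~` N) z by [].
    by rewrite translate_cover => -[g _ Dz]; exists g.
  apply: negligibleU; first by apply/negligibleP.
  apply: negligible_bigcup_countable => // g.
  have [->|g1] := eqVneq g 1%g; first by rewrite rest1; exact: negligible_set0.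
  have dg0 : mu (dom g) = 0%E by rewrite -(h g g1) nuD // => z [].
  apply/negligibleP; first exact: mrest.
  exact: etrans (esym (mu_dom g1)) dg0.
rewrite nuD; last by move=> z [].
rewrite mu_dom //; apply: measure_negligible => //.
apply: (@negligibleS _ _ _ _ (Y `\` X)); first by move=> z [[]].
exact/negligibleP.
Qed.

End CouplingRestriction.

Lemma ediv_eq1 (R : realType) (x y : \bar R) :
  (0 < y)%E -> (y < +oo)%E -> (x / y = 1 <-> x = y)%E.
Proof.
case: y => [y||] //; rewrite lte_fin => y0 _; rewrite inver gt_eqF // muleC.
have := eqe_pdivrMl 1%E x (lt0r_neq0 y0); rewrite mule1 => e.
by split=> /eqP; [rewrite e => /eqP|rewrite -e => /eqP].
Qed.

Lemma edivy (R : realType) (y : \bar R) :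
  (0 < y)%E -> (y < +oo)%E -> (+oo / y = +oo)%E.
Proof.
case: y => [y||] //; rewrite lte_fin => y0 _.
by rewrite inver gt_eqF // gt0_mulye // lte_fin invr_gt0.
Qed.

Lemma coupling_embedding (R : realType) (L G : groupType)
    (S : SMI_coupling R L G) :
  countable [set: L] -> countable [set: G] ->
  exists E : random_embedding R L G,
    (forall g, g != 1%g -> re_mu E (re_dom g) = 0%E) <-> smi_index S = 1%E.
Proof.
move=> cL cG; have [[Y X] [/= fY fX Xfin [M [mM M0 XYM]]]] := smi_domains S.
have mpL := mp_action_fst (smi_mp S); have mpG := mp_action_snd (smi_mp S).
have mX : measurable X by case: fX.
have mY : measurable Y by case: fY.
(* The points where the return to [Y] or to [X] fails to exist uniquely, or which lie in [X] but not
   in [Y]. *)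
have nB : (smi_mu S).-negligible
    (~` [set z | exists! l, Y (smi_act (l, 1%g) z)] `|`
    ~` [set z | exists! g, X (smi_act (1%g, g) z)] `|` (X `\` Y)).
  apply: negligibleU; last by exists M.
  by apply: negligibleU; [apply: (fundamental_domain_uniq cL mpL)|
    apply: (fundamental_domain_uniq cG mpG)].
have cLG : countable [set: (L * G)%type] by rewrite -setXTT; exact: countableX.
have [N [mN N0 BN Ninv]] := invariant_hull cLG (smi_mp S) nB.
have XY z : ~ N z -> X z -> Y z.
  by move=> nN Xz; apply: contrapT => nY; apply: nN; apply: BN; right.
have Yex z : ~ N z -> exists! l, Y (smi_act (l, 1%g) z).
  by move=> nN; apply: contrapT => nY; apply: nN; apply: BN; left; left.
have Xex z : ~ N z -> exists! g, X (smi_act (1%g, g) z).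
  by move=> nN; apply: contrapT => nY; apply: nN; apply: BN; left; right.
have [E hE] := restriction_embedding cG mX mY mN N0 Xfin Ninv XY Yex Xex.
have X0 := coupling_domain_gt0 cG mX mN N0 Ninv Xex.
exists E; rewrite hE (smi_indexE cL cG fY fX) (ediv_eq1 _ X0 Xfin).
(* Up to a null set [Y] is the disjoint union of [X] and [Y] minus [X]; as [X] has finite measure,
   it can be cancelled. *)
have XY0 : smi_mu S (X `\` Y) = 0%E.
  by apply: measure_negligible; [exact: measurableD|exists M].
have XI : smi_mu S X = smi_mu S (X `&` Y).
  transitivity (smi_mu S (X `\` Y) + smi_mu S (X `&` Y))%E;
    first exact: measureDI.
  by rewrite XY0 add0e.
have YI : smi_mu S Y = (smi_mu S (Y `\` X) + smi_mu S X)%E.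
  by rewrite XI setIC; exact: measureDI.
have Xf : smi_mu S X \is a fin_num by rewrite ge0_fin_numE.
rewrite YI; split=> [->|YX]; first by rewrite add0e.
by rewrite -[LHS](addeK _ Xf) [X in (X - _)%E]YX subee.
Qed.

(** * The coupling of the free products *)

Lemma countable_free_product (G H : groupType) :
  countable [set: G] -> countable [set: H] -> countable [set: free_product G H].
Proof.
move=> /countable_injP[f fi] /countable_injP[h hi]; apply/countable_injP.
pose code (a : G + H) : nat + nat :=
  match a with inl x => inl (f x) | inr y => inr (h y) end.
have codeI : injective code.
  by move=> [x|x] [y|y] //= [xy]; congr (_ _); [apply: fi|apply: hi];
    rewrite ?inE.
exists (fun u : free_product G H => pickle (map code u)) => u v _ _.
move=> /(pcan_inj pickleK) /(inj_map codeI); exact: val_inj.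
Qed.

Lemma measurable_fun_discrete d (T : measurableType d) (G : groupType)
    (cG : countable [set: G]) (f : T -> discrete cG) :
  (forall g, measurable [set x | f x = g]) -> measurable_fun setT f.
Proof.
move=> mf _ A _; rewrite setTI.
have -> : f @^-1` A = \bigcup_(g : G) ([set x | f x = g] `&` [set _ | A g]).
  by apply/seteqP; split=> x; [exists (f x)|move=> [g _ [/= ->]]].
apply: countable_bigcupT_measurable => // g; apply: measurableI => //.
have [Ag|nA] := pselect (A g).
  by have -> : [set _ : T | A g] = setT by apply/seteqP; split.
by have -> : [set _ : T | A g] = set0 by rewrite -subset0.
Qed.

Lemma free_product_inr_inj (G H : groupType) :
  injective (@free_product_inr G H).
Proof.
move=> x y /(congr1 (@free_product_word G H)); rewrite /= /word_cons /=.
case: (eqVneq x 1%g) => [->|_]; case: (eqVneq y 1%g) => [->|_] //=.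
by move=> [].
Qed.

Lemma free_product_inl_inj (G H : groupType) :
  injective (@free_product_inl G H).
Proof.
move=> x y /(congr1 (@free_product_word G H)); rewrite /= /word_cons /=.
case: (eqVneq x 1%g) => [->|_]; case: (eqVneq y 1%g) => [->|_] //=.
by move=> [].
Qed.

(** The products [g h] with [h] in [H] already suffice; [h = 1] gives the one-letter word. *)
Lemma infinite_headl (G H : groupType) (g : G) : g != 1%g ->
  infinite_set [set: H] ->
  infinite_set [set v : free_product G H | exists t,
    v = inl g :: t :> seq (G + H)].
Proof.
move=> g1 infH finV; apply: infH.
pose i (h : H) : free_product G H :=
  (free_product_inl H g * free_product_inr G h)%g.
have -> : [set: H] = i @^-1` [set v | exists t, v = inl g :: t :> seq (G + H)].
  apply/seteqP; split=> h // _ /=; rewrite /word_cons /= g1 /=.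
  case: eqVneq => _ /=; last by exists [:: inr h]; rewrite /word_cons /= g1.
  by exists [::]; rewrite /word_cons /= g1.
by apply: finite_preimage => // h k _ _ /mulgI /free_product_inr_inj.
Qed.

Lemma infinite_headr (G H : groupType) (h : H) : h != 1%g ->
  infinite_set [set: G] ->
  infinite_set [set v : free_product G H | exists t,
    v = inr h :: t :> seq (G + H)].
Proof.
move=> h1 infG finV; apply: infG.
pose i (g : G) : free_product G H :=
  (free_product_inr G h * free_product_inl H g)%g.
have -> : [set: G] = i @^-1` [set v | exists t, v = inr h :: t :> seq (G + H)].
  apply/seteqP; split=> g // _ /=; rewrite /word_cons /= h1 /=.
  case: eqVneq => _ /=; last by exists [:: inl g]; rewrite /word_cons /= h1.
  by exists [::]; rewrite /word_cons /= h1.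
by apply: finite_preimage => // g k _ _ /mulgI /free_product_inl_inj.
Qed.

Lemma pointwise_fundamental_domain (R : realType) d (T : measurableType d)
    (mu : {measure set T -> \bar R}) (D : groupType) (act : D -> T -> T)
    (Z : set T) :
  mp_action mu act -> measurable Z ->
  mu.-negligible (~` \bigcup_(g in [set: D]) (act g @` Z)) ->
  (forall g z, Z z -> Z (act g z) -> g = 1%g) ->
  fundamental_domain mu act Z.
Proof.
move=> mpa mZ ZT Zd; have [_ aM _ _] := mpa; split=> // [|g h gh].
  by apply: negligibleS ZT => z [[_ []]//|[]].
rewrite /ae_eq_set setY0 (_ : _ `&` _ = set0); first exact: negligible_set0.
rewrite -subset0 => _ [[z Zz <-] [y Zy gz]].
have zy : act (h^-1 * g)%g z = y by rewrite aM -gz (mp_actionV mpa).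
have /mulg1_eq : (h^-1 * g)%g = 1%g by apply: (Zd _ z) => //; rewrite zy.
by rewrite invgK => e; rewrite e eqxx in gh.
Qed.

Lemma counting1 (R : realType) (T : choiceType) (x : T) :
  counting [set x] = 1%E :> \bar R.
Proof. by rewrite /counting asboolT // fset_set1 finmap.cardfs1. Qed.

Lemma counting_infinite (R : realType) (T : choiceType) (A : set T) :
  infinite_set A -> counting A = +oo%E :> \bar R.
Proof. by move=> iA; rewrite /counting asboolF. Qed.

Section FreeProductCoupling.
Context (R : realType) (L1 L2 G1 G2 : groupType).
Context (E1 : random_embedding R L1 G1) (E2 : random_embedding R L2 G2).
Context (cG1 : countable [set: G1]) (cG2 : countable [set: G2])
  (cF : countable [set: free_product G1 G2])
  (cL : countable [set: free_product L1 L2]).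
Local Notation F := (free_product G1 G2).
Local Notation P := (re_space E1 * re_space E2)%type.
Local Notation base := (@base_dom R L1 L2 G1 G2 E1 E2).
Local Notation Omega := (P * discrete cF)%type.

Let nu : {measure set P -> \bar R} := (re_mu E1 \x re_mu E2)%E.
Let mu : {measure set Omega -> \bar R} := (nu \x @discrete_counting _ cF R)%E.

Let muX (A : set P) (B : set (discrete cF)) : measurable A ->
  mu (A `*` B) = (nu A * counting B)%E.
Proof. by move=> mA; apply: product_measure1E. Qed.

Let measurable_slices (A : F -> set P) : (forall v, measurable (A v)) ->
  measurable [set z : Omega | A z.2 z.1].
Proof.
move=> mA.
have -> : [set z : Omega | A z.2 z.1] = \bigcup_(v : F) (A v `*` [set v]).
  by apply/seteqP; split=> [[x v] Av|[x v] [w _ [/= Aw ->]]] //; exists v.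
by apply: countable_bigcupT_measurable => // v; exact: measurableX.
Qed.

Let slices_null (A : F -> set P) : (forall v, measurable (A v)) ->
  (forall v, nu (A v) = 0%E) -> mu [set z : Omega | A z.2 z.1] = 0%E.
Proof.
move=> mA A0; apply: measure_negligible; first exact: measurable_slices.
have : mu.-negligible (\bigcup_(v : F) (A v `*` [set v])).
  apply: (negligible_bigcup_countable cF) => v; apply/negligibleP;
    first exact: measurableX.
  by rewrite [LHS]muX // A0 mul0e.
by apply: negligibleS => -[x v] Av; exists v.
Qed.

Lemma measurable_letter_act a :
  measurable_fun setT (@letter_act R L1 L2 G1 G2 E1 E2 a).
Proof.
have [_ _ am _] := re_mp E1; have [_ _ bm _] := re_mp E2.
case: a => l /=; apply: measurable_fun_pair => //; exact: measurableT_comp.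
Qed.

Lemma measurable_letter_cocycle a g :
  measurable [set x | @letter_cocycle R L1 L2 G1 G2 E1 E2 a x = g].
Proof.
have slice (K : groupType) (cK : countable [set: K]) (c : P -> K) (i : K -> F) :
    (forall k, measurable [set x | c x = k]) ->
      measurable [set x | i (c x) = g].
  move=> mc; have mcd : measurable_fun setT (c : P -> discrete cK).
    exact: measurable_fun_discrete.
  by have := mcd measurableT [set k | i k = g] I; rewrite setTI.
case: a => l /=.
- apply: (slice _ cG1 (fun x => re_cocycle l x.1)) => k.
  have := @measurable_fst _ _ (re_space E1) (re_space E2) measurableT _
    (@re_cocycle_measurable _ _ _ E1 l k).
  by rewrite setTI.
- apply: (slice _ cG2 (fun x => re_cocycle l x.2)) => k.
  have := @measurable_snd _ _ (re_space E1) (re_space E2) measurableT _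
    (@re_cocycle_measurable _ _ _ E2 l k).
  by rewrite setTI.
Qed.

Lemma measurable_letter_step a :
  measurable_fun setT (letter_step a : Omega -> Omega).
Proof.
apply: measurable_fun_pair.
  by apply: (measurableT_comp (measurable_letter_act a)).
apply: measurable_fun_discrete => g.
(* Solving for the cocycle leaves a measurable condition on the base point over each fixed group
   element. *)
have -> : [set z : Omega | (letter_cocycle a z.1 * z.2)%g = g] =
    [set z : Omega | letter_cocycle a z.1 = (g * (z.2 : F)^-1)%g].
  apply/seteqP; split=> z /= h; first by rewrite -h mulgK.
  by rewrite h mulgVK.
exact: (measurable_slices (fun v => measurable_letter_cocycle a (g * v^-1)%g)).
Qed.

Lemma letter_act_mp a A : measurable A ->
  nu (@letter_act R L1 L2 G1 G2 E1 E2 a @^-1` A) = nu A.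
Proof.
have [_ _ am ap] := re_mp E1; have [_ _ bm bp] := re_mp E2.
move=> mA; case: a => l.
- by apply: (skew_product_mp (phi := re_act l) (psi := fun _ => id)) => // B;
    exact: ap.
- by apply: (skew_product_mp (phi := id) (psi := fun _ => re_act l)) =>
    // _ B; exact: bp.
Qed.

Lemma letter_step_mp a A : measurable A ->
  mu ((letter_step a : Omega -> Omega) @^-1` A) = mu A.
Proof.
apply: (@skew_product_mp _ _ _ _ _ nu (@discrete_counting _ cF R) (letter_act a)
  (fun x v => (letter_cocycle a x * v)%g : discrete cF)).
- exact: measurable_letter_act.
- exact: letter_act_mp.
- move=> x B _; apply: (counting_bij _ (g := fun v =>
    ((letter_cocycle a x)^-1 * v)%g)).
    exact: mulKg.
  exact: mulVKg.
Qed.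

Lemma mulr_mp (g : F) A : measurable A ->
  mu ((fun z : Omega => (z.1, (z.2 * g)%g : discrete cF)) @^-1` A) = mu A.
Proof.
apply: (@skew_product_mp _ _ _ _ _ nu (@discrete_counting _ cF R) id
  (fun _ v => (v * g)%g : discrete cF)) => //.
move=> _ B _; apply: (counting_bij _ (g := fun v => (v * g^-1)%g)).
  exact: mulgK.
exact: mulgVK.
Qed.

Lemma measurable_mulr (g : F) :
  measurable_fun setT (fun z : Omega => (z.1, (z.2 * g)%g : discrete cF)).
Proof.
apply: measurable_fun_pair => //.
have mg : measurable_fun setT (fun v : discrete cF =>
  (v * g)%g : discrete cF) by [].
exact: (measurableT_comp mg measurable_snd).
Qed.

(** The cocycle multiplies from the left, so right multiplication by inverses is a commuting action
    of [F]. *)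
Definition coupling_act (p : free_product L1 L2 * F) (z : Omega) : Omega :=
  ((word_step p.1 z).1, ((word_step p.1 z).2 * p.2^-1)%g).

Lemma coupling_act_mp : mp_action mu coupling_act.
Proof.
have mw (w : seq (L1 + L2)) :
    measurable_fun setT (word_step w : Omega -> Omega).
  elim: w => [|a w mw]; first exact: measurable_id.
  exact: (measurableT_comp (measurable_letter_step a) mw).
have pw (w : seq (L1 + L2)) A : measurable A ->
    mu ((word_step w : Omega -> Omega) @^-1` A) = mu A.
  elim: w A => //= a w IH A mA; rewrite -(letter_step_mp a mA) -[RHS]IH //.
  by rewrite -[X in measurable X]setTI; exact: measurable_letter_step.
split.
- by move=> [x v]; rewrite /coupling_act /= invg1 mulg1.
- move=> [w g] [w' g'] z; rewrite /coupling_act /= word_step_mul.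
  by rewrite word_step_mulr /= -surjective_pairing invgM mulgA.
- move=> [w g] /=; exact: (measurableT_comp (measurable_mulr g^-1%g) (mw w)).
- move=> [w g] A mA; rewrite -(mulr_mp g^-1%g mA) -[RHS](pw w) //.
  by rewrite -[X in measurable X]setTI; exact: measurable_mulr.
Qed.

Let base_measurable : measurable base.
Proof. by apply: measurableX; exact: re_dom_measurable. Qed.

Let head_measurable v : measurable [set x | @head_dom R L1 L2 G1 G2 E1 E2 x v].
Proof.
case: v => [|[g|g] v] /=.
- by have -> : [set _ : P | True] = setT by apply/seteqP.
- have -> : [set x : P | re_dom g x.1] = re_dom g `*` setT by apply/seteqP;
    split=> x // [].
  by apply: measurableX => //; exact: re_dom_measurable.
- have -> : [set x : P | re_dom g x.2] = setT `*` re_dom g by apply/seteqP;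
    split=> x // [].
  by apply: measurableX => //; exact: re_dom_measurable.
Qed.

Let nuX A B : measurable A -> measurable B ->
  nu (A `*` B) = (re_mu E1 A * re_mu E2 B)%E.
Proof. by move=> mA mB; apply: product_measure1E. Qed.

Let base_conull : nu (~` base) = 0%E.
Proof.
have mD1 : measurable (~` re_dom 1%g : set (re_space E1)).
  by apply: measurableC; exact: re_dom_measurable.
have mD2 : measurable (~` re_dom 1%g : set (re_space E2)).
  by apply: measurableC; exact: re_dom_measurable.
apply: measure_negligible; first exact: measurableC.
have : nu.-negligible ((~` re_dom 1%g) `*` setT `|` setT `*` (~` re_dom 1%g)).
  apply: negligibleU; apply/negligibleP; try exact: measurableX.
    by rewrite [LHS]nuX // re_dom_conull mul0e.
  by rewrite [LHS]nuX // re_dom_conull mule0.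
apply: negligibleS => x nx; have [D1|] := pselect (re_dom 1%g x.1);
  last by left.
by right; split => // D2; apply: nx.
Qed.

Let base_fin : (nu base < +oo)%E.
Proof.
rewrite (_ : nu _ = (re_mu E1 (re_dom 1%g) * re_mu E2 (re_dom 1%g))%E).
  by rewrite ltey_eq fin_numM //; apply: fin_num_measure;
    exact: re_dom_measurable.
by apply: nuX; exact: re_dom_measurable.
Qed.

Let base_gt0 : (0 < nu base)%E.
Proof.
rewrite (_ : nu _ = (re_mu E1 (re_dom 1%g) * re_mu E2 (re_dom 1%g))%E).
  by apply: mule_gt0; exact: re_dom_gt0.
by apply: nuX; exact: re_dom_measurable.
Qed.

Let Y : set Omega := @word_dom R L1 L2 G1 G2 E1 E2.
Let X : set Omega := base `*` [set 1%g].

Let mY : measurable Y.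
Proof.
apply: (measurable_slices (A := fun v => base `&` [set x | head_dom x v])) => v.
exact: measurableI.
Qed.

Let mX : measurable X.
Proof. exact: measurableX. Qed.

Let muX_fin : mu X = nu base.
Proof. by rewrite [LHS]muX // counting1 mule1. Qed.

Let conull_negligible (A : set Omega) : (forall z, base z.1 -> A z) ->
  mu.-negligible (~` A).
Proof.
move=> DA; have : mu.-negligible [set z : Omega | (~` base) z.1].
  apply/negligibleP; last by apply: (slices_null (A := fun=> ~` base)) =>
    // v; exact: measurableC.
  by apply: (measurable_slices (A := fun=> ~` base)) => // v;
    exact: measurableC.
by apply: negligibleS => z nA Dz; apply: nA; exact: DA.
Qed.

Let mpL : mp_action mu (fun w => coupling_act (w, 1%g)).
Proof. exact: mp_action_fst coupling_act_mp. Qed.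

Let mpG : mp_action mu (fun g => coupling_act (1%g, g)).
Proof. exact: mp_action_snd coupling_act_mp. Qed.

Let coupling_actL w z : coupling_act (w, 1%g) z = word_step w z.
Proof. by rewrite /coupling_act /= invg1 mulg1 -surjective_pairing. Qed.

Let domainL : fundamental_domain mu (fun w => coupling_act (w, 1%g)) Y.
Proof.
apply: pointwise_fundamental_domain => //.
  apply: conull_negligible => -[x v] /= Dx; have [w wY] := word_dom_ex v Dx.
  exists w^-1%g => //; exists (coupling_act (w, 1%g) (x, v));
    first by rewrite coupling_actL.
  exact: (mp_actionV mpL).
move=> w z Yz; rewrite coupling_actL => Yw; apply: val_inj.
exact: (word_dom_uniq (free_product_reduced w) Yz Yw).
Qed.

Let domainG : fundamental_domain mu (fun g => coupling_act (1%g, g)) X.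
Proof.
apply: pointwise_fundamental_domain => //.
  apply: conull_negligible => -[x v] /= Dx; exists v^-1%g => //;
    exists (x, 1%g) => //.
  by rewrite /coupling_act /= invgK mul1g.
by move=> g [x v] [/= _ ->] [_] /=; rewrite mul1g => /eqP;
  rewrite invg_eq1 => /eqP.
Qed.

Let XY : X `<=` Y.
Proof. by move=> [x v] [/= Dx ->]. Qed.

Let mu_infinite : mu [set: Omega] = +oo%E.
Proof.
apply/eqP; rewrite -leye_eq; apply: (@le_trans _ _ (mu (base `*` setT))).
  suff -> : mu (base `*` setT) = +oo%E by [].
  rewrite [LHS]muX // counting_infinite ?gt0_muley // => finF.
  apply: (re_infinite E1).
  have -> : [set: G1] = free_product_inl G2 @^-1` setT by [].
  by apply: finite_preimage => // x y _ _ /free_product_inl_inj.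
by apply: le_measure; rewrite ?inE //; exact: measurableX.
Qed.

(** Outside [X], a point of [Y] over [base] carries a nonempty word whose head, a nontrivial letter,
    admits the base point in its slice. Null slices thus make [Y] minus [X] null, while one slice of
    positive measure contributes its measure once for each of infinitely many words. *)
Lemma free_product_coupling : exists S : SMI_coupling R (free_product L1 L2) F,
  let null1 := forall g, g != 1%g -> re_mu E1 (re_dom g) = 0%E in
  let null2 := forall g, g != 1%g -> re_mu E2 (re_dom g) = 0%E in
  (null1 /\ null2 -> smi_index S = 1%E) /\
  (~ (null1 /\ null2) -> smi_index S = +oo%E).
Proof.
have sO : standard_borel R Omega.
  apply: standard_borel_prod; last exact: standard_borel_discrete.
  by apply: standard_borel_prod; exact: re_standard.
have dom : exists YX : set Omega * set Omega,
    [/\ fundamental_domain mu (fun w => coupling_act (w, 1%g)) YX.1,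
        fundamental_domain mu (fun g => coupling_act (1%g, g)) YX.2,
        (mu YX.2 < +oo)%E & ae_subset mu YX.2 YX.1].
  exists (Y, X); split => //=; first by rewrite muX_fin.
  have XY0 : X `\` Y = set0 by rewrite setD_eq0.
  by rewrite /ae_subset XY0; exact: negligible_set0.
pose S := SMICoupling sO mu_infinite coupling_act_mp dom.
exists S => null1 null2.
have -> : smi_index S = (mu Y / mu X)%E by exact: (@smi_indexE _ _ _ S).
have X0 : (0 < mu X)%E by rewrite muX_fin.
have Xf : (mu X < +oo)%E by rewrite muX_fin.
split=> [[n1 n2]|nn].
  apply/(ediv_eq1 _ X0 Xf); apply/eqP; rewrite eq_le; apply/andP; split;
    last first.
    by apply: le_measure; rewrite ?inE.
  (* The points of [Y] over a nonempty [v] lie in [A v], which is null because the head of a reduced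
     word is nontrivial. *)
  pose A (v : F) : set P := match v : seq (G1 + G2) with
    | [::] => set0
    | inl g :: _ => re_dom g `*` setT
    | inr g :: _ => setT `*` re_dom g
    end.
  have mA v : measurable (A v).
    rewrite /A; case: (v : seq _) => [//|[g|g] _]; apply: measurableX => //;
      exact: re_dom_measurable.
  have A0 v : nu (A v) = 0%E.
    have := free_product_reduced v; rewrite /A; case: (v : seq _) => [|[g|g] w].
    - by rewrite measure0.
    - rewrite reduced_cons => /and3P[g1 _ _].
      by rewrite [LHS]nuX ?n1 ?mul0e //; exact: re_dom_measurable.
    - rewrite reduced_cons => /and3P[g1 _ _].
      by rewrite [LHS]nuX ?n2 ?mule0 //; exact: re_dom_measurable.
  have mZ := measurable_slices mA; have Z0 := slices_null mA A0.
  apply: (@le_trans _ _ (mu (X `|` [set z : Omega | A z.2 z.1]))).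
    apply: le_measure; rewrite ?inE //; first exact: measurableU.
    move=> [x v] [/= Dx hv]; rewrite /X /A /=.
    case: v hv => -[|[g|g] w] rw /= hv; [left|right|right] => //.
    by split => //; exact: val_inj.
  apply: le_trans (measureU2 mu mX mZ) _.
  rewrite [X in (_ + X)%E](_ : _ = 0%E); last exact: Z0.
  by rewrite adde0.
suff -> : mu Y = +oo%E by exact: edivy.
have big (A : set P) (V : set F) :
    measurable A -> (0 < nu A)%E -> infinite_set V ->
    A `*` V `<=` Y -> mu Y = +oo%E.
  move=> mA A0 iV AVY; apply/eqP; rewrite -leye_eq;
    apply: (@le_trans _ _ (mu (A `*` V))).
    suff -> : mu (A `*` V) = +oo%E by [].
    by rewrite [LHS]muX // counting_infinite // gt0_muley.
  by apply: le_measure; rewrite ?inE //; exact: measurableX.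
have pos (L G : groupType) (E : random_embedding R L G) (g : G) :
    re_mu E (re_dom g) <> 0%E -> (0 < re_mu E (re_dom g))%E.
  by move=> /eqP n; rewrite lt0e n measure_ge0.
have : ~ null1 \/ ~ null2 by apply/not_andP.
case=> /existsNP[g /not_implyP[g1 /pos g0]].
(* Membership in [Y] depends on the head only, so over this set every word starting with [g] is
   allowed; there are infinitely many since [G2] is infinite. *)
- apply: (big (re_dom g `*` re_dom 1%g) _ _ _
    (infinite_headl g1 (re_infinite E2))).
  + by apply: measurableX; exact: re_dom_measurable.
  + rewrite [ltRHS]nuX; [|exact: re_dom_measurable..].
    by apply: mule_gt0 => //; exact: re_dom_gt0.
  + move=> [x v] [[/= gx Dx] [t e]]; split; last by rewrite /= e.
    by split => //; exact: re_dom_sub gx.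
- apply: (big (re_dom 1%g `*` re_dom g) _ _ _
    (infinite_headr g1 (re_infinite E1))).
  + by apply: measurableX; exact: re_dom_measurable.
  + rewrite [ltRHS]nuX; [|exact: re_dom_measurable..].
    by apply: mule_gt0 => //; exact: re_dom_gt0.
  + move=> [x v] [[/= Dx gx] [t e]]; split; last by rewrite /= e.
    by split => //; exact: re_dom_sub gx.
Qed.

End FreeProductCoupling.

Theorem theoremA (R : realType) (L1 L2 G1 G2 : groupType)
    (cL1 : countable [set: L1]) (cL2 : countable [set: L2])
    (cG1 : countable [set: G1]) (cG2 : countable [set: G2]) :
  (SMI R L1 G1 -> SMI R L2 G2 ->
     SMI R (free_product L1 L2) (free_product G1 G2)) /\
  (forall (S1 : SMI_coupling R L1 G1) (S2 : SMI_coupling R L2 G2)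
      (c1 c2 : \bar R),
    smi_index S1 = c1 -> smi_index S2 = c2 ->
    exists S : SMI_coupling R (free_product L1 L2) (free_product G1 G2),
      smi_index S = (if (c1 == 1) && (c2 == 1) then 1 else +oo)%E).
Proof.
have main (S1 : SMI_coupling R L1 G1) (S2 : SMI_coupling R L2 G2) :
    exists S : SMI_coupling R (free_product L1 L2) (free_product G1 G2),
      smi_index S =
        (if (smi_index S1 == 1) && (smi_index S2 == 1) then 1 else +oo)%E.
  have [E1 i1] := coupling_embedding S1 cL1 cG1.
  have [E2 i2] := coupling_embedding S2 cL2 cG2.
  have [S [S1oo Soo]] := free_product_coupling E1 E2 cG1 cG2
    (countable_free_product cG1 cG2) (countable_free_product cL1 cL2).
  exists S; case: ifPn => [/andP[/eqP/i1 n1 /eqP/i2 n2]|nc]; first exact: S1oo.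
  by apply: Soo => -[/i1 c1 /i2 c2]; rewrite c1 c2 !eqxx in nc.
split=> [[S1] [S2]|S1 S2 c1 c2 <- <-]; last exact: main.
by have [S _] := main S1 S2.
Qed.
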